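(* Let $\mathcal{F}$ be a convex family of real-valued functions on $\mathcal{X}$ (not necessarily bounded), let $x_1,\dots,x_n\in\mathcal{X}$ be some $n$ points, and let $\mathbb{P}_n:=n^{-1}\sum_{i=1}^n\delta_{x_i}$. For all $f_0\in\mathcal{F}$ define $$r(f_0):=\arg\max_{r\ge0}\ \widehat{\mathcal{W}}(B_n(f_0,r))-\frac{r^2}{2}$$ and $$L_x(f_0):=\max_{g\in B_n(f_0,1),\ t\ge0}\ \frac{\widehat{\mathcal{W}}(B_n(g,t))-\widehat{\mathcal{W}}(B_n(f_0,r(f_0)))-Cn^{-1}}{\|g-f_0\|_{\mathbb{P}_n}+t},$$ where $C\in(1,\infty)$ is some absolute constant. Then the following lower bound holds: $$\mathbb{E}_\xi\int(\hat f_n-f_0)^2\,d\mathbb{P}_n\;\ge\;\max\Big\{\frac{\big(\widehat{\mathcal{W}}(B_n(f_0,1))-Cn^{-1}\big)^2}{4},\ L_x(f_0)^2\Big\}.$$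
   Context: Model (fixed design): $x_1,\dots,x_n\in\mathcal{X}$ are fixed points of a domain $\mathcal{X}$, $\xi_1,\dots,\xi_n$ are i.i.d. $N(0,1)$, and $Y_i=f_0(x_i)+\xi_i$ with $f_0\in\mathcal{F}$. The least squares estimator (ERM with respect to square loss) is $\hat f_n=\Psi\big(\arg\min_{f\in\mathcal{F}}\sum_{i=1}^n(Y_i-f(x_i))^2\big)$, where $\Psi$ is a function that selects a particular solution in the set of minimizers. $\mathbb{E}_\xi$ is expectation over $\xi_1,\dots,\xi_n$. Notation: $\|f\|_{\mathbb{P}_n}$ is the $L_2(\mathbb{P}_n)$ norm, $\|f\|_{\mathbb{P}_n}^2=\frac1n\sum_{i=1}^nf(x_i)^2$; $B_n(f,r)=\{g\in\mathcal{F}:\|g-f\|_{\mathbb{P}_n}\le r\}$; for $\mathcal{G}\subseteq\mathcal{F}$, $\widehat{\mathcal{W}}(\mathcal{G})=\mathbb{E}_\xi\sup_{f\in\mathcal{G}}\frac1n\sum_{i=1}^n\xi_if(x_i)$ denotes the (empirical) Gaussian averages of $\mathcal{G}$.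
   Formalization: The first term is read with a positive part, (max{0, Ŵ(B_n(f_0,1)) − C/n})²/4, since as printed the bound fails for F = {f_0}, where the risk is 0 and the term is C²/(4n²); the set of least squares minimizers is taken to be nonempty for every noise realization. *)

(* Defs.v *)
From HB Require Import structures.
From mathcomp Require Import all_boot all_order all_algebra.
From mathcomp Require Import all_classical all_reals all_analysis.

Set Implicit Arguments.
Unset Strict Implicit.
Unset Printing Implicit Defensive.

Import Order.TTheory GRing.Theory Num.Theory.

Local Open Scope classical_set_scope.
Local Open Scope ring_scope.

Section Extrema.
Context {R : realType} {A : Type}.
Implicit Types (D : set A) (J : A -> R).

Definition argmin_set D J : set A :=
  [set a | D a /\ forall b, D b -> J a <= J b].

Definition argmax_set D J : set A :=
  [set a | D a /\ forall b, D b -> J b <= J a].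

End Extrema.

Section GaussianNoise.
Context {d : measure_display} {T : measurableType d} {R : realType}.
Variable P : probability T R.

Definition mutually_independent (I : finType) (xi : I -> {RV P >-> R}) : Prop :=
  forall (J : {set I}) (B : I -> set R), (forall i, measurable (B i)) ->
    fine (P (\bigcap_(i in [set` J]) (xi i @^-1` B i))) =
    \prod_(i in J) fine (P (xi i @^-1` B i)).

(* The two set functions are only compared on Borel sets: a measure carries
   no information on its values at non-measurable sets. *)
Definition standard_normal (Z : {RV P >-> R}) : Prop :=
  forall B : set R, measurable B -> distribution P Z B = normal_prob 0 1 B.

Definition iid_standard_normal (I : finType) (xi : I -> {RV P >-> R}) : Prop :=
  mutually_independent xi /\ forall i, standard_normal (xi i).

End GaussianNoise.

Section FixedDesign.
Context {R : realType} {X : Type} {n : nat}.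
Variables (F : set (X -> R)) (x : 'I_n -> X).

(* Integral of h against the empirical measure P_n of the design points,
   counted with multiplicity. *)
Definition emp_int (h : X -> R) : R := n%:R^-1 * \sum_(i < n) h (x i).

Definition emp_norm (f : X -> R) : R :=
  Num.sqrt (emp_int (fun z => f z ^+ 2)).

Definition emp_ball (f : X -> R) (r : R) : set (X -> R) :=
  [set g | F g /\ emp_norm (g \- f) <= r].

Definition lse_minimizers (y : 'I_n -> R) : set (X -> R) :=
  argmin_set F (fun f => \sum_(i < n) (y i - f (x i)) ^+ 2).

Context {d : measure_display} {T : measurableType d} {P : probability T R}.
Variable xi : 'I_n -> {RV P >-> R}.

Definition response (f0 : X -> R) (w : T) (i : 'I_n) : R :=
  f0 (x i) + xi i w.

Definition lse (Psi : set (X -> R) -> (X -> R)) (f0 : X -> R) (w : T) :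
  X -> R := Psi (lse_minimizers (response f0 w)).

(* [sup] and [fine] return 0 on unbounded sets and at infinity. On the balls
   [emp_ball g t] with [F g] and [0 <= t], to which this is applied below,
   the set is nonempty and bounded for every w (Cauchy-Schwarz) and the
   expectation is finite. *)
Definition gauss_avg (G : set (X -> R)) : R :=
  fine 'E_P[fun w =>
    sup [set n%:R^-1 * \sum_(i < n) (xi i w * f (x i)) | f in G]].

Definition opt_radius (f0 : X -> R) : R :=
  xget 0 (argmax_set [set r : R | 0 <= r]
    (fun r => gauss_avg (emp_ball f0 r) - r ^+ 2 / 2)).

(* The maximum is read as a supremum. Pairs with zero denominator are left out
   explicitly, since division by 0 is total; at such pairs the numerator is
   negative for C > 0. *)
Definition L_bound (C : R) (f0 : X -> R) : R :=
  sup [set ell | exists (g : X -> R) (t : R),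
    [/\ emp_ball f0 1 g, 0 <= t, 0 < emp_norm (g \- f0) + t &
      ell = (gauss_avg (emp_ball g t)
             - gauss_avg (emp_ball f0 (opt_radius f0)) - C / n%:R)
            / (emp_norm (g \- f0) + t)]].

End FixedDesign.

(* Main.v *)
From HB Require Import structures.
Require Import Defs.
From mathcomp Require Import all_boot all_order all_algebra.
From mathcomp Require Import all_classical all_reals all_analysis.
From mathcomp Require Import measurable_realfun ring lra.

(* Write [v] for the projection error of the noise [xi] onto [K = F - f0] and
   [H r] for the supremum of [<xi, u>] over [u] in [K] with [|u| <= r], so that
   [W r = E (H r)] is the Gaussian average of the ball of radius [r].  The
   variational inequality of the projection bounds [<xi, u>] over the ball
   [B(g, t)] by [<xi, v> - |v|^2 + |v| (|g| + t)].  Taking expectations, the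
   first bound follows from [E <xi, v> <= sqrt (E |v|^2)], and the second one
   from [E (<xi, v> - |v|^2) <= W (r0) + C / n].  For the latter, concavity of
   [H] gives [<xi, v> - |v|^2 <= H r0 + Z^2 / 4] where [Z] is the fluctuation
   of the slope of [H] over [[r0, 3/2 r0]], and the slope of [W] there is at
   most [r0] because [r0] maximizes [W r - r^2 / 2].

   The variance of [H r] is [O (r^2 / n)] by a Maurey-Pisier argument: if
   [xi_th = cos th xi + sin th xi'] with [xi'] an independent copy, rotation
   invariance of the Gaussian law gives [V (2 th) <= 4 V th] for
   [V th = E (H (xi) - H (xi_th))^2], and [V th] is of order [th^2 r^2 / n] for
   small [th] by testing with a near-maximizer of [H]. *)

Set Implicit Arguments.
Unset Strict Implicit.
Unset Printing Implicit Defensive.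

Import Order.TTheory GRing.Theory Num.Theory.

Local Open Scope classical_set_scope.
Local Open Scope ring_scope.

(** * Support functions and projections in R^n *)

Section InnerProduct.
Context {R : realType} {n : nat}.
Implicit Types (u v w : 'rV[R]_n) (a : R).

(** The difficulty is that [|v|] is random: [<xi, v> - |v|^2] is only known to be at most the
    supremum over all [r] of [H r - r^2], and this has to be compared with one deterministic value
    of [W], up to an error [C / n] that depends neither on [K] nor on [r0]. Concavity reduces the
    supremum to the two fixed radii [rho] and [3/2 rho], where [rho] is [r0] when that is positive.
    Dividing the fluctuation over this interval by its length [rho / 2] turns a variance of order
    [rho^2 / n] into one of order [1 / n], so the scale disappears. Past [rho] the possible growth
    [(r - rho) (rho + Z)] is beaten by the penalty [r^2]: its cross term absorbs the slope [rho],
    and its remaining square absorbs the slope [Z] at the price [Z^2 / 4]. Thus only second moments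
    of the fluctuation enter. Rotations bound them directly for a supremum, which may be neither
    attained nor differentiable in the noise. *)

Definition ip u v : R := n%:R^-1 * \sum_i u 0 i * v 0 i.
Definition ipnorm u : R := Num.sqrt (ip u u).

Lemma ipC u v : ip u v = ip v u.
Proof. by congr (_ * _); apply: eq_bigr => i _; rewrite mulrC. Qed.

Lemma ipDl u v w : ip (u + v) w = ip u w + ip v w.
Proof.
rewrite /ip -mulrDr -big_split /=; congr (_ * _).
by apply: eq_bigr => i _; rewrite mxE mulrDl.
Qed.

Lemma ipZl a u w : ip (a *: u) w = a * ip u w.
Proof.
rewrite /ip [RHS]mulrCA [in RHS]mulr_sumr; congr (_ * _).
by apply: eq_bigr => i _; rewrite mxE mulrA.
Qed.

Lemma ipNl u w : ip (- u) w = - ip u w.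
Proof. by rewrite -scaleN1r ipZl mulN1r. Qed.

Lemma ipDr u v w : ip w (u + v) = ip w u + ip w v.
Proof. by rewrite ipC ipDl !(ipC w). Qed.

Lemma ipZr a u w : ip w (a *: u) = a * ip w u.
Proof. by rewrite ipC ipZl (ipC w). Qed.

Lemma ipNr u w : ip w (- u) = - ip w u.
Proof. by rewrite ipC ipNl (ipC w). Qed.

Definition ipE := (ipDl, ipDr, ipNl, ipNr, ipZl, ipZr).

Lemma ip0r u : ip u 0 = 0.
Proof. by rewrite -(scale0r u) ipZr mul0r. Qed.

Lemma ip_ge0 u : 0 <= ip u u.
Proof.
by rewrite mulr_ge0 ?invr_ge0 ?ler0n // sumr_ge0 // => i _; exact: sqr_ge0.
Qed.

Lemma ipnorm_ge0 u : 0 <= ipnorm u.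
Proof. exact: sqrtr_ge0. Qed.

Lemma ipnorm_sqr u : ipnorm u ^+ 2 = ip u u.
Proof. by rewrite sqr_sqrtr // ip_ge0. Qed.

Lemma ipnorm0 : ipnorm 0 = 0.
Proof. by rewrite /ipnorm ip0r sqrtr0. Qed.

Lemma ipnorm_le u r : 0 <= r -> (ipnorm u <= r) = (ip u u <= r ^+ 2).
Proof. by move=> r0; rewrite -ipnorm_sqr ler_sqr // nnegrE ?ipnorm_ge0. Qed.

(** Nonnegativity of [ip w w] at [w = (|v| + e) u - (|u| + e) v]. The slack [e] keeps both weights
    positive when a norm vanishes and is sent to 0 at the end. *)
Lemma CauchySchwarz_ip u v : ip u v <= ipnorm u * ipnorm v.
Proof.
have nnp w e : 0 < e -> 0 < ipnorm w + e by have := ipnorm_ge0 w; lra.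
have key e : 0 < e -> ip u v <= (ipnorm u + e) * (ipnorm v + e).
  move=> e0; have a0 := nnp u e e0; have b0 := nnp v e e0.
  have := ip_ge0 ((ipnorm v + e) *: u - (ipnorm u + e) *: v).
  rewrite !ipE (ipC v u) -!ipnorm_sqr; have := ipnorm_ge0 u; have := ipnorm_ge0 v.
  move: (ipnorm u) (ipnorm v) a0 b0 => a b a0 b0 b1 a1 h.
  rewrite -(ler_pM2l (mulr_gt0 a0 b0)).
  have : ((b + e) * a) ^+ 2 <= ((a + e) * (b + e)) ^+ 2.
    by rewrite ler_sqr ?nnegrE; nra.
  have : ((a + e) * b) ^+ 2 <= ((a + e) * (b + e)) ^+ 2.
    by rewrite ler_sqr ?nnegrE; nra.
  nra.
apply/ler_addgt0Pr => e e0; have := ipnorm_ge0 u; have := ipnorm_ge0 v.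
move: (ipnorm u) (ipnorm v) key => a b key b0 a0.
set m := a + b + 1; have m0 : 0 < m by rewrite /m; lra.
pose d := Num.min 1 (e / m).
have d0 : 0 < d by rewrite lt_min ltr01 divr_gt0.
have d1 : d <= 1 by rewrite ge_min lexx.
have dm : d * m <= e by rewrite -ler_pdivlMr // ge_min lexx orbT.
by have := key d d0; rewrite /m in dm; nra.
Qed.

Lemma ipnormN u : ipnorm (- u) = ipnorm u.
Proof. by rewrite /ipnorm !ipE opprK. Qed.

Lemma ip_norm_le u v : `|ip u v| <= ipnorm u * ipnorm v.
Proof.
rewrite ler_norml CauchySchwarz_ip andbT.
have := CauchySchwarz_ip (- u) v; rewrite ipnormN ipNl; lra.
Qed.

Lemma ipnormD u v : ipnorm (u + v) <= ipnorm u + ipnorm v.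
Proof.
rewrite ipnorm_le ?addr_ge0 ?ipnorm_ge0 // !ipE (ipC v u) sqrrD !ipnorm_sqr.
by have := CauchySchwarz_ip u v; lra.
Qed.

Lemma ipnormB u v : ipnorm (u - v) = ipnorm (v - u).
Proof. by rewrite -ipnormN opprB. Qed.

Lemma ipnormZ a u : 0 <= a -> ipnorm (a *: u) = a * ipnorm u.
Proof.
by move=> a0; rewrite /ipnorm !ipE mulrA sqrtrM ?mulr_ge0 // -expr2 sqrtr_sqr ger0_norm.
Qed.

End InnerProduct.

Section SupportFunction.
Context {R : realType} {n : nat}.
Variable K : set 'rV[R]_n.

(** [K] is not assumed closed, so the supremum may not be attained; the proofs use the
    near-maximizers of [ksup_adherent] instead. *)
Definition ksup (r : R) (y : 'rV[R]_n) : R :=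
  sup [set ip y v | v in [set v | K v /\ ipnorm v <= r]].

Hypothesis K0 : K 0.
Hypothesis Kconv : forall u v a, K u -> K v -> 0 <= a <= 1 ->
  K (a *: u + (1 - a) *: v).
Implicit Types (r : R) (y v : 'rV[R]_n).

Lemma ksup_has_sup r y : 0 <= r ->
  has_sup [set ip y v | v in [set v | K v /\ ipnorm v <= r]].
Proof.
move=> r0; split; first by exists (ip y 0), 0 => //; split; rewrite ?ipnorm0.
exists (ipnorm y * r) => _ [v [_ vr] <-].
by apply: (le_trans (CauchySchwarz_ip _ _)); rewrite ler_wpM2l ?ipnorm_ge0.
Qed.

Lemma ksup_ub r y v : K v -> ipnorm v <= r -> ip y v <= ksup r y.
Proof.
move=> Kv vr; have r0 := le_trans (ipnorm_ge0 v) vr.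
by apply: (ub_le_sup (proj2 (ksup_has_sup y r0))); exists v.
Qed.

Lemma ksup_le r y b : 0 <= r -> (forall v, K v -> ipnorm v <= r -> ip y v <= b) ->
  ksup r y <= b.
Proof.
move=> r0 h; apply: ge_sup; first exact: (proj1 (ksup_has_sup y r0)).
by move=> _ [v [Kv vr] <-]; exact: h.
Qed.

Lemma ksup_adherent r y e : 0 <= r -> 0 < e ->
  exists v, [/\ K v, ipnorm v <= r & ksup r y < ip y v + e].
Proof.
move=> r0 e0; have [_ [v [Kv vr] <-] h] := sup_adherent e0 (ksup_has_sup y r0).
by exists v; split => //; rewrite -ltrBlDr.
Qed.

Lemma ksup_ge0 r y : 0 <= r -> 0 <= ksup r y.
Proof. by move=> r0; rewrite -(ip0r y); apply: ksup_ub; rewrite ?ipnorm0. Qed.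

Lemma ksup_le_nn r y : 0 <= r -> ksup r y <= r * ipnorm y.
Proof.
move=> r0; apply: ksup_le => // v _ vr; rewrite mulrC.
by apply: (le_trans (CauchySchwarz_ip _ _)); rewrite ler_wpM2l ?ipnorm_ge0.
Qed.

Lemma ksup_mono r r' y : 0 <= r -> r <= r' -> ksup r y <= ksup r' y.
Proof.
move=> r0 rr'; apply: ksup_le => // v Kv vr.
by apply: ksup_ub => //; exact: le_trans rr'.
Qed.

Lemma ksup_lipschitz r y z : 0 <= r -> `|ksup r y - ksup r z| <= r * ipnorm (y - z).
Proof.
move=> r0.
have h a b : ksup r a - ksup r b <= r * ipnorm (a - b).
  rewrite lerBlDr; apply: ksup_le => // v Kv vr.
  rewrite -[a in ip a v](subrK b) ipDl lerD ?ksup_ub //.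
  by rewrite mulrC (le_trans (CauchySchwarz_ip _ _)) // ler_wpM2l ?ipnorm_ge0.
by rewrite ler_norml h andbT lerNl opprB ipnormB h.
Qed.

(** A convex combination of near-maximizers for [r] and [s] stays in [K], and its norm is at most
    the combined radius. *)
Lemma ksup_concave r s a y : 0 <= r -> 0 <= s -> 0 <= a <= 1 ->
  a * ksup r y + (1 - a) * ksup s y <= ksup (a * r + (1 - a) * s) y.
Proof.
move=> r0 s0 a01; apply/ler_addgt0Pr => e e0.
have [u [Ku ur hu]] := ksup_adherent y r0 e0.
have [v [Kv vs hv]] := ksup_adherent y s0 e0.
case/andP : (a01) => a0 a1.
have b0 : 0 <= 1 - a by lra.
have : ipnorm (a *: u + (1 - a) *: v) <= a * r + (1 - a) * s.
  by rewrite (le_trans (ipnormD _ _)) // !ipnormZ // lerD // ler_wpM2l.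
by move=> /(ksup_ub y (Kconv Ku Kv a01)); rewrite ipDr !ipZr; nra.
Qed.

(* Past [3/2 rho] concavity extends the chord over [rho, 3/2 rho]; before, it
   is monotonicity. *)
Lemma ksup_sub_sqr rho z r y : 0 < rho -> 0 <= z -> 0 <= r ->
  ksup (3 / 2 * rho) y - ksup rho y <= rho / 2 * (rho + z) ->
  ksup r y - r ^+ 2 <= ksup rho y + z ^+ 2 / 4.
Proof.
move=> rho0 z0 r0 hz.
have [rr|rr] := lerP r rho; first by have := ksup_mono y r0 rr; nra.
have [r2|r2] := lerP r (3 / 2 * rho).
  have := ksup_mono y r0 r2; have := sqr_ge0 (z - rho); have := sqr_ge0 rho.
  have : rho ^+ 2 <= r ^+ 2 by rewrite ler_sqr ?nnegrE //; lra.
  lra.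
pose a := rho / 2 / (r - rho).
have rp : 0 < r - rho by lra.
have ar : a * (r - rho) = rho / 2 by rewrite /a divfK ?gt_eqF.
have a0 : 0 < a by rewrite /a !divr_gt0.
have a1 : a <= 1 by nra.
have a01 : 0 <= a <= 1 by rewrite a1 ltW.
have := ksup_concave y r0 (ltW rho0) a01.
have -> : a * r + (1 - a) * rho = 3 / 2 * rho by nra.
move=> hc.
have : a * (ksup r y - ksup rho y) <= a * ((r - rho) * (rho + z)).
  by rewrite mulrA ar; nra.
rewrite ler_pM2l // => h; have := sqr_ge0 (z / 2 - (r - rho)).
have := mulr_gt0 rp rho0; have := sqr_ge0 rho; lra.
Qed.

End SupportFunction.

Section Projection.
Context {R : realType} {n : nat}.
Variable K : set 'rV[R]_n.
Hypothesis K0 : K 0.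
Hypothesis Kconv : forall u v a, K u -> K v -> 0 <= a <= 1 ->
  K (a *: u + (1 - a) *: v).
Implicit Types (y v p : 'rV[R]_n).

(** A relation rather than a function: a nearest point may fail to exist when [K] is not closed.
    Here the estimator supplies one. *)
Definition nearest p y := K p /\ forall v, K v -> ip (y - p) (y - p) <= ip (y - v) (y - v).

(** Moving from [p] towards [v] by a weight [a] changes the squared distance by
    [- 2 a <y - p, v - p> + a^2 s], which cannot be negative; [a] is taken small enough that
    [a s <= e]. *)
Lemma nearest_variational p y v : nearest p y -> K v -> ip (y - p) (v - p) <= 0.
Proof.
move=> [Kp h] Kv; apply/ler_addgt0Pr => e e0; rewrite add0r.
have := ip_ge0 (v - p); set s := ip (v - p) (v - p) => s0.
pose a := Num.min 1 (e / (s + 1)).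
have s1 : 0 < s + 1 by lra.
have a0 : 0 < a by rewrite lt_min ltr01 divr_gt0.
have a1 : a <= 1 by rewrite ge_min lexx.
have am : a * (s + 1) <= e by rewrite -ler_pdivlMr // ge_min lexx orbT.
have a01 : 0 <= a <= 1 by rewrite a1 ltW.
have := h _ (Kconv Kv Kp a01).
have -> : y - (a *: v + (1 - a) *: p) = (y - p) - a *: (v - p).
  by apply/rowP => i; rewrite !mxE; ring.
rewrite (ipDl (y - p) (- (a *: (v - p)))) !(ipDr (y - p)) !ipNl !ipNr !ipZl !ipZr.
rewrite -/s (ipC (v - p)).
move=> hh.
have : a * (2 * ip (y - p) (v - p)) <= a * (a * s) by nra.
rewrite ler_pM2l //; nra.
Qed.

(** The two variational inequalities add up to [|p - p'|^2 <= <y - y', p - p'>]. This continuity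
    makes the projection measurable in the noise. *)
Lemma nearest_nonexpansive p y p' y' : nearest p y -> nearest p' y' ->
  ipnorm (p - p') <= ipnorm (y - y').
Proof.
move=> py py'.
have h1 := nearest_variational py (proj1 py').
have h2 := nearest_variational py' (proj1 py).
have := CauchySchwarz_ip (y - y') (p - p'); have := ipnorm_sqr (p - p').
have := ipnorm_ge0 (p - p'); have := ipnorm_ge0 (y - y').
have [->//|] := eqVneq (ipnorm (p - p')) 0; move=> neq h3 h4 h5 h6.
have p0 : 0 < ipnorm (p - p') by rewrite lt_neqAle eq_sym neq.
rewrite -(ler_pM2r p0); apply: le_trans h6; rewrite -expr2 h5.
move: h1 h2; rewrite !ipE (ipC p' p); lra.
Qed.

Lemma nearest_sqr p y : nearest p y -> ipnorm p ^+ 2 <= ip y p.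
Proof.
move=> py; have := nearest_variational py K0; rewrite ipnorm_sqr !ipE ip0r.
by have := ip0r y; have := ip0r p; lra.
Qed.

Lemma nearest_le p y : nearest p y -> ipnorm p <= ipnorm y.
Proof.
move=> /nearest_sqr h.
have [->|neq] := eqVneq (ipnorm p) 0; first exact: ipnorm_ge0.
have p0 : 0 < ipnorm p by rewrite lt_neqAle eq_sym neq ipnorm_ge0.
rewrite -(ler_pM2r p0) -expr2.
exact: le_trans h (CauchySchwarz_ip _ _).
Qed.

(** The variational inequality bounds [<y - p, v>] by [<y - p, p>]; the remaining [<p, v>] is
    bounded by Cauchy-Schwarz, with [|v| <= |g| + d]. *)
Lemma nearest_ub p y v g d : nearest p y -> K v -> ipnorm (v - g) <= d ->
  ip y v <= ip y p + ipnorm p * (ipnorm g + d) - ipnorm p ^+ 2.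
Proof.
move=> py Kv vg; have := nearest_variational py Kv.
have h1 := CauchySchwarz_ip p v.
have h2 : ipnorm v <= ipnorm g + d.
  by rewrite -(subrK g v) addrC (le_trans (ipnormD _ _)) // lerD.
have := ler_wpM2l (ipnorm_ge0 p) h2; rewrite ipnorm_sqr !ipE; lra.
Qed.

End Projection.

(** * Rotation invariance of the planar Gaussian law *)

Section LebesgueInvariance.
Context {R : realType}.
Local Notation mu := (@lebesgue_measure R).
Local Notation RR := (measurableTypeR R).
Local Open Scope ereal_scope.

Lemma measurable_shift (a : R) : measurable_fun [set: RR] ((fun x => x + a)%R : RR -> RR).
Proof. exact: measurable_funD. Qed.

Lemma ge0_integral_shift (f : R -> \bar R) (a : R) :
  measurable_fun [set: R] f -> (forall x, 0 <= f x) ->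
  \int[mu]_x f (x + a)%R = \int[mu]_x f x.
Proof.
move=> mf f0.
pose sh := (fun x : RR => x + a : RR)%R.
transitivity (\int[pushforward mu (sh : RR -> RR)]_x f x).
  by rewrite ge0_integral_pushforward //; exact: measurable_shift.
apply: eq_measure_integral; first exact: measurable_shift.
move=> msh A mA _; apply/esym.
apply: lebesgue_measure_unique => // _ [[x y] _ <-].
transitivity (mu `](x - a)%R, (y - a)%R]%classic); last first.
  rewrite /pushforward; congr (mu _).
  by apply/seteqP; split => z /=; rewrite /sh !in_itv /=; lra.
rewrite !lebesgue_measure_itv /= !lte_fin ltrD2r.
by case: ifP => // _; rewrite -!EFinD; congr EFin; lra.
Qed.

Local Notation J f := (\int[mu \x mu]_z f z).

Lemma ge0_integral_shear2 (g : R * R -> \bar R) (b : R) :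
  measurable_fun [set: RR * RR] g -> (forall z, 0 <= g z) ->
  J (fun z => g (z.1, z.2 + b * z.1)%R) = J g.
Proof.
move=> mg g0.
rewrite fubini_tonelli1 //; last first.
  apply: measurableT_comp => //; apply: measurable_fun_pair => //.
  by apply: measurable_funD => //; apply: measurable_funM.
rewrite fubini_tonelli1 //.
apply: eq_integral => x _.
rewrite /fubini_F /=.
apply: (@ge0_integral_shift (fun y => g (x, y))) => //.
by apply: measurableT_comp => //; exact: pair1_measurable.
Qed.

Lemma ge0_integral_shear1 (g : R * R -> \bar R) (b : R) :
  measurable_fun [set: RR * RR] g -> (forall z, 0 <= g z) ->
  J (fun z => g (z.1 + b * z.2, z.2)%R) = J g.
Proof.
move=> mg g0.
rewrite fubini_tonelli2 //; last first.
  apply: measurableT_comp => //; apply: measurable_fun_pair => //.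
  by apply: measurable_funD => //; apply: measurable_funM.
rewrite fubini_tonelli2 //.
apply: eq_integral => y _.
rewrite /fubini_G /=.
apply: (@ge0_integral_shift (fun x => g (x, y))) => //.
by apply: measurableT_comp => //; exact: pair2_measurable.
Qed.

Definition rot2 (c s : R) (z : R * R) : R * R :=
  (c * z.1 + s * z.2, c * z.2 - s * z.1)%R.

Lemma measurable_rot2 c s : measurable_fun [set: RR * RR] (rot2 c s : RR * RR -> RR * RR).
Proof.
apply: measurable_fun_pair.
  by apply: measurable_funD; apply: measurable_funM.
by apply: measurable_funB; apply: measurable_funM.
Qed.

(* A rotation which is not a multiple of the half turn is a product of three
   shears. *)
Lemma ge0_integral_rot2 (g : R * R -> \bar R) (c s : R) :
  (c ^+ 2 + s ^+ 2 = 1)%R -> s != 0%R ->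
  measurable_fun [set: RR * RR] g -> (forall z, 0 <= g z) ->
  J (g \o rot2 c s) = J g.
Proof.
(* [a] is the tangent of the half angle; the three shears have parameters [a], [- s], [a]. *)
move=> cs s0 mg g0; pose a := ((1 - c) / s)%R.
have as_ : (a * s = 1 - c)%R by rewrite divfK.
have ac : (a * (1 + c) = s)%R.
  by apply: (mulIf s0); rewrite mulrAC as_; lra.
pose sh1 (h : R * R -> \bar R) := fun z => h (z.1 + a * z.2, z.2)%R.
pose sh2 (h : R * R -> \bar R) := fun z => h (z.1, z.2 + (- s) * z.1)%R.
have msh1 h : measurable_fun [set: RR * RR] h -> measurable_fun [set: RR * RR] (sh1 h).
  move=> mh; apply: measurableT_comp => //; apply: measurable_fun_pair => //.
  by apply: measurable_funD => //; apply: measurable_funM.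
have msh2 h : measurable_fun [set: RR * RR] h -> measurable_fun [set: RR * RR] (sh2 h).
  move=> mh; apply: measurableT_comp => //; apply: measurable_fun_pair => //.
  by apply: measurable_funD => //; apply: measurable_funM.
transitivity (J (sh1 (sh2 (sh1 g)))); last first.
  rewrite (ge0_integral_shear1 a (msh2 _ (msh1 _ mg))); last by move=> z; exact: g0.
  rewrite (ge0_integral_shear2 (- s) (msh1 _ mg)); last by move=> z; exact: g0.
  exact: ge0_integral_shear1.
apply: eq_integral => -[x y] _ /=; congr (g (_, _)) => /=.
  have -> : (x + a * y + a * (y + - s * (x + a * y)) =
     x * (1 - a * s) + a * (2 - a * s) * y)%R by ring.
  by rewrite as_ -[in LHS]ac; ring.
have -> : (y + - s * (x + a * y) = y * (1 - a * s) - s * x)%R by ring.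
by rewrite as_; ring.
Qed.

End LebesgueInvariance.

Section GaussianDensity.
Context {R : realType}.
Local Notation mu := (@lebesgue_measure R).
Local Notation RR := (measurableTypeR R).
Local Notation gauss := (normal_prob (0 : R) 1).
Local Notation phi := (normal_pdf (0 : R) 1).
Local Open Scope ereal_scope.

(** Change of variables with the Radon-Nikodym derivative, which agrees almost everywhere with [phi]
    because both have the same integral over every measurable set. *)
Lemma ge0_integral_normal_prob (f : R -> \bar R) :
  (forall x, 0 <= f x) -> measurable_fun [set: RR] f ->
  \int[gauss]_x f x = \int[mu]_x (f x * (phi x)%:E).
Proof.
move=> f0 mf.
have dom := normal_prob_dominates (0 : R) 1.
have mphi : measurable_fun [set: RR] (EFin \o phi).
  by apply/measurable_EFinP; exact: measurable_normal_pdf.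
rewrite -(Radon_Nikodym_SigmaFinite.change_of_variables dom) //.
apply: ae_eq_integral => //.
- apply: emeasurable_funM => //; apply: (measurable_int mu).
  exact: Radon_Nikodym_SigmaFinite.f_integrable.
- exact: emeasurable_funM.
- apply: ae_eqe_mul2l; apply: integral_ae_eq => //.
  + exact: Radon_Nikodym_SigmaFinite.f_integrable.
  + by move=> E _ mE; rewrite -Radon_Nikodym_SigmaFinite.f_integral.
Qed.

Lemma normal_pdf01E (x : R) :
  phi x = ((Num.sqrt (pi *+ 2))^-1 * expR (- (x ^+ 2 / 2)))%R.
Proof.
rewrite normal_pdfE ?oner_neq0 // /normal_peak /normal_fun subr0 expr1n.
by rewrite mulNr mul1r.
Qed.

Lemma ge0_integral_gauss2 (h : R * R -> \bar R) :
  (forall z, 0 <= h z) -> measurable_fun [set: RR * RR] h ->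
  \int[gauss \x gauss]_z h z =
  \int[mu \x mu]_z (h z * (phi z.1 * phi z.2)%:E).
Proof.
move=> h0 mh.
have mphi : measurable_fun [set: RR] (EFin \o phi).
  by apply/measurable_EFinP; exact: measurable_normal_pdf.
have p0 x : 0 <= (phi x)%:E by rewrite lee_fin normal_pdf_ge0.
have mhx x : measurable_fun [set: RR] (fun y => h (x, y)).
  by apply: measurableT_comp => //; exact: pair1_measurable.
have mF : measurable_fun [set: RR] (fubini_F gauss h).
  exact: measurable_fun_fubini_tonelli_F.
rewrite fubini_tonelli1 //.
rewrite ge0_integral_normal_prob //; last first.
  by move=> x; apply: integral_ge0.
rewrite fubini_tonelli1 //; last 2 first.
- apply: emeasurable_funM => //; apply/measurable_EFinP.
  by apply: measurable_funM; apply: (measurableT_comp (@measurable_normal_pdf R 0 1)).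
- by move=> z; rewrite mule_ge0 // lee_fin mulr_ge0 ?normal_pdf_ge0.
apply: eq_integral => x _; rewrite /fubini_F /=.
rewrite ge0_integral_normal_prob // muleC -ge0_integralZl //.
- by apply: eq_integral => y _; rewrite EFinM muleCA.
- exact: emeasurable_funM.
- by move=> y _; exact: mule_ge0.
Qed.

(** The product density depends on [z.1 ^+ 2 + z.2 ^+ 2] only, and planar Lebesgue measure is
    rotation invariant. Rectangles are enough, since the law of a family is specified on boxes. *)
Lemma gauss2_rot2 (A B : set R) (c s : R) :
  (c ^+ 2 + s ^+ 2 = 1)%R -> s != 0%R ->
  measurable (A : set RR) -> measurable (B : set RR) ->
  (gauss \x gauss) (rot2 c s @^-1` (A `*` B)) = gauss A * gauss B.
Proof.
move=> cs s0 mA mB.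
have mAB : measurable (A `*` B : set (RR * RR)) by exact: measurableX.
have mr : measurable (rot2 c s @^-1` (A `*` B) : set (RR * RR)).
  by rewrite -[X in measurable X]setTI; exact: measurable_rot2.
have ind0 (D : set (R * R)) z : 0 <= (\1_D z : R)%:E by rewrite lee_fin.
have mind (D : set (RR * RR)) : measurable D ->
    measurable_fun [set: RR * RR] (fun z => (\1_D z : R)%:E).
  by move=> mD; apply/measurable_EFinP; exact: measurable_indic.
have mphi2 : measurable_fun [set: RR * RR] (fun z => (phi z.1 * phi z.2)%:E).
  apply/measurable_EFinP.
  by apply: measurable_funM; apply: (measurableT_comp (@measurable_normal_pdf R 0 1)).
have ie (D : set (RR * RR)) : measurable D -> (gauss \x gauss) D =
    \int[mu \x mu]_z ((\1_D z : R)%:E * (phi z.1 * phi z.2)%:E).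
  move=> mD; rewrite -ge0_integral_gauss2 //; last exact: mind.
  by rewrite integral_indic // setIT.
transitivity ((gauss \x gauss) (A `*` B)); last exact: product_measure1E.
rewrite ie // ie //.
rewrite -[RHS](ge0_integral_rot2 cs s0); last 2 first.
- by apply: emeasurable_funM => //; exact: mind.
- by move=> z; rewrite mule_ge0 // lee_fin mulr_ge0 ?normal_pdf_ge0.
apply: eq_integral => z _ /=; congr (_ * _).
rewrite !normal_pdf01E /= mulrACA [in RHS]mulrACA; congr (_ * _)%:E.
rewrite -!expRD -!opprD; congr (expR (- _)).
have -> : ((c * z.1 + s * z.2) ^+ 2 / 2 + (c * z.2 - s * z.1) ^+ 2 / 2 =
  (c ^+ 2 + s ^+ 2) * (z.1 ^+ 2 / 2 + z.2 ^+ 2 / 2))%R by ring.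
by rewrite cs mul1r.
Qed.
End GaussianDensity.

(** * Families of independent standard normal variables *)

Section ContinuousComposite.
Context {R : realType} {d : measure_display} {T : measurableType d} {I : finType}.
Variable Z : I -> T -> R.
Hypothesis mZ : forall i, measurable_fun [set: T] (Z i).

(* Open sets of [R^I] are countable unions of rational boxes. *)
Lemma measurable_fun_of_continuity (f : T -> R) :
  (forall w (e : R), 0 < e -> exists2 dlt : R, 0 < dlt &
    forall w', (forall i, `|Z i w - Z i w'| < dlt) -> `|f w - f w'| < e) ->
  measurable_fun [set: T] f.
Proof.
move=> cf; apply: (measurability _ (RGenOInfty.measurableE R)).
move=> _ [_ [a ->] <-]; rewrite setTI.
pose box (u : {ffun I -> rat} * nat) : set T :=
  \bigcap_(i in [set: I]) 
    (Z i @^-1` `]ratr (u.1 i) - u.2.+1%:R^-1, ratr (u.1 i) + u.2.+1%:R^-1[).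
have mbox u : measurable (box u).
  apply: fin_bigcap_measurable => [|i _]; first exact: finite_finset.
  by rewrite -[X in measurable X]setTI; apply: mZ.
rewrite (_ : _ @^-1` _ = \bigcup_u
   (if `[< box u `<=` [set w | a < f w] >] then box u else set0)); last first.
  apply/seteqP; split => w /=; rewrite in_itv /= andbT; last first.
    by move=> [u _]; case: ifPn => // /asboolP h /h.
  move=> afw; have [|dlt dlt0 h] := cf w (f w - a); first by rewrite subr_gt0.
  have [k kdlt] : exists k, (k.+1%:R^-1 : R) < dlt / 2.
    have /ltr_add_invr[k] : 0 < dlt / 2 by rewrite divr_gt0.
    by rewrite add0r; exists k.
  have k0 : 0 < (k.+1%:R^-1 : R) by rewrite invr_gt0.
  have /choice[q hq] : forall i, exists q : rat, `|ratr q - Z i w| < k.+1%:R^-1.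
    move=> i; have [|q] := @rat_in_itvoo R (Z i w - k.+1%:R^-1) (Z i w + k.+1%:R^-1).
      by rewrite ltrBlDr -addrA ltrDl addr_gt0.
    by rewrite in_itv /= -ltr_distl; exists q.
  have bw : box ([ffun i => q i], k) w.
    by move=> i _; rewrite /= in_itv /= -ltr_distl ffunE distrC hq.
  exists ([ffun i => q i], k) => //; case: ifPn => // /asboolP[] w' bw' /=.
  have : `|f w - f w'| < f w - a.
    apply: h => i; have := bw i Logic.I; have := bw' i Logic.I.
    rewrite /= !in_itv /= -!ltr_distl ffunE => h1 h2.
    rewrite (le_lt_trans (ler_distD (ratr (q i)) _ _)) //.
    rewrite (distrC (Z i w)) (distrC (Z i w')) in h1 h2 *.
    by move: (k.+1%:R^-1 : R) kdlt h1 h2 => t; lra.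
  by rewrite ltr_norml => /andP[]; lra.
apply: countable_bigcupT_measurable => [|u]; first exact: countableP.
by case: ifP.
Qed.

End ContinuousComposite.

Section GaussianFamily.
Context {R : realType}.
Local Notation gauss := (normal_prob (0 : R) 1).

(** Plain functions over an arbitrary finite index type, so that copies, rotations and subfamilies
    of the noise are again instances. Boxes determine the joint law, and a factor [setT] drops a
    coordinate. *)
Definition gaussian_family {d} {T : measurableType d} (P : probability T R)
    {I : finType} (Z : I -> T -> R) : Prop :=
  (forall i, measurable_fun [set: T] (Z i)) /\
  forall B : I -> set R, (forall i, measurable (B i)) ->
    P (\bigcap_(i in [set: I]) (Z i @^-1` B i)) =
    (\prod_i fine (gauss (B i)))%:E.

Definition boxes (I : finType) : set (set (I -> measurableTypeR R)) :=
  [set A | exists2 B : I -> set (measurableTypeR R), (forall i, measurable (B i)) &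
    A = \bigcap_(i in [set: I]) ((fun y : I -> measurableTypeR R => y i) @^-1` B i)].

Local Notation euclid I := (g_sigma_algebraType (@boxes I)).

Lemma measurable_coord (I : finType) (i : I) :
  measurable_fun [set: euclid I] (fun y : euclid I => y i).
Proof.
move=> _ B mB; rewrite setTI; apply: sub_sigma_algebra.
exists (fun j => if j == i then B else setT) => [j|]; first by case: ifP.
apply/seteqP; split => y /=; first by move=> By j _; case: eqP => // ->.
by move=> /(_ i Logic.I); rewrite /= eqxx.
Qed.

Lemma measurable_to_euclid (I : finType) d (T : measurableType d) (Z : I -> T -> R) :
  (forall i, measurable_fun [set: T] (Z i)) ->
  measurable_fun [set: T] ((fun w i => Z i w) : T -> euclid I).
Proof.
move=> mZ.
apply: (@measurability _ _ T (euclid I) setT (fun w i => Z i w) (@boxes I) erefl).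
move=> _ [_ [B mB ->] <-].
rewrite setTI preimage_bigcap.
apply: fin_bigcap_measurable => [|i _]; first exact: finite_finset.
by rewrite -[X in measurable X]setTI; apply: (mZ i) => //; exact: mB.
Qed.

(** The two image laws agree on boxes, which are stable under intersection and generate the
    sigma-algebra of [euclid I]. The probability spaces may differ, so the noise on [T] can be
    compared with its copies on [T * T]. *)
Lemma gaussian_family_integral (I : finType) d (T : measurableType d)
    (P : probability T R) (Z : I -> T -> R)
    d' (T' : measurableType d') (P' : probability T' R) (Z' : I -> T' -> R)
    (G : (I -> R) -> \bar R) :
  gaussian_family P Z -> gaussian_family P' Z' ->
  measurable_fun [set: euclid I] G -> (forall y, 0 <= G y)%E ->
  (\int[P]_w G (fun i => Z i w) = \int[P']_w G (fun i => Z' i w))%E.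
Proof.
move=> [mZ lZ] [mZ' lZ'] mG G0.
have mz := measurable_to_euclid mZ; have mz' := measurable_to_euclid mZ'.
transitivity (\int[pushforward P ((fun w i => Z i w) : T -> euclid I)]_y G y)%E.
  by rewrite ge0_integral_pushforward.
transitivity (\int[pushforward P' ((fun w i => Z' i w) : T' -> euclid I)]_y G y)%E; last first.
  by rewrite ge0_integral_pushforward.
apply: eq_measure_integral => A mA _.
refine (@measure_unique _ R (euclid I) (@boxes I) (fun=> setT) erefl _ _ _ _ _ _ _ A mA).
- move=> _ _ [B mB ->] [C mC ->]; exists (fun i => B i `&` C i).
    by move=> i; exact: measurableI.
  by rewrite bigcapI.
- move=> _; exists (fun=> setT) => //.
  by apply/seteqP; split.
- by rewrite bigcup_const //; exists 0%N.
- by move=> _ [B mB ->]; exact: etrans (lZ B mB) (esym (lZ' B mB)).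
- by move=> _; rewrite /= /pushforward preimage_setT probability_setT ltry.
Qed.

End GaussianFamily.

Section GaussianRotation.
Context {R : realType} {d : measure_display} {T : measurableType d}.
Variables (P : probability T R) (I : finType) (Z : I -> T -> R).
Local Notation gauss := (normal_prob (0 : R) 1).
Local Notation RR := (measurableTypeR R).

Definition rotate_pair (a b : I) (c s : R) (i : I) (w : T) : R :=
  if i == a then (rot2 c s (Z a w, Z b w)).1
  else if i == b then (rot2 c s (Z a w, Z b w)).2 else Z i w.

(** Restrict [P] to the event [rest] that the other coordinates lie in their boxes. The image of
    this measure under [(Z a, Z b)] is [kappa] times the planar Gaussian law, by agreement on
    rectangles, so that the rotated event reduces to [gauss2_rot2]. *)
Lemma gaussian_family_rotate_pair (a b : I) (c s : R) : a != b ->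
  c ^+ 2 + s ^+ 2 = 1 -> s != 0 ->
  gaussian_family P Z -> gaussian_family P (rotate_pair a b c s).
Proof.
move=> ab cs s0 [mZ lZ].
have mpair : measurable_fun [set: T] ((fun w => (Z a w, Z b w)) : T -> RR * RR).
  by apply: measurable_fun_pair; exact: mZ.
split => [i|B mB].
  rewrite /rotate_pair; case: eqP => _; last case: eqP => _ //.
  - by rewrite /rot2 /=; apply: measurable_funD; apply: measurable_funM.
  - by rewrite /rot2 /=; apply: measurable_funB; apply: measurable_funM.
pose rest := \bigcap_(i in [set i | (i != a) && (i != b)]) (Z i @^-1` B i).
have mrest : measurable rest.
  apply: fin_bigcap_measurable => [|i _]; first exact: finite_finset.
  by rewrite -[X in measurable X]setTI; apply: mZ.
pose kappa := \prod_(i | (i != a) && (i != b)) fine (gauss (B i)).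
have kappa0 : 0 <= kappa by apply: prodr_ge0 => i _; exact: fine_ge0.
have splitE (A C : set R) : measurable A -> measurable C ->
    P ([set w | (A `*` C) (Z a w, Z b w)] `&` rest) =
    (kappa%:E * (gauss A * gauss C))%E.
  move=> mA mC.
  pose B' i := if i == a then A else if i == b then C else B i.
  have Ba : B' a = A by rewrite /B' eqxx.
  have Bb : B' b = C by rewrite /B' eq_sym (negbTE ab) eqxx.
  have -> : [set w | (A `*` C) (Z a w, Z b w)] `&` rest =
      \bigcap_(i in [set: I]) (Z i @^-1` B' i).
    apply/seteqP; split => w /=.
      move=> [[/= hA hC] hr] i _; rewrite /B' /=.
      case: eqP => [->//|/eqP ia]; case: eqP => [->//|/eqP ib].
      by apply: hr; rewrite /= ia ib.
    move=> h; split; first by split; [rewrite -Ba|rewrite -Bb]; exact: h.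
    move=> i /andP[ia ib]; have := h i Logic.I.
    by rewrite /B' /= (negbTE ia) (negbTE ib).
  rewrite lZ => [|i]; last by rewrite /B'; case: ifP => // _; case: ifP.
  rewrite (bigD1 a) //= (bigD1 b) /=; last by rewrite eq_sym.
  rewrite Ba Bb mulrA mulrC !EFinM !fineK; last 2 first.
  - exact: fin_num_measure.
  - exact: fin_num_measure.
  congr (_%:E * _)%E; apply: eq_bigr => i /andP[ia ib].
  by rewrite /B' (negbTE ia) (negbTE ib).
have gaussE (D : set (RR * RR)) : measurable D ->
    P ([set w | D (Z a w, Z b w)] `&` rest) = (kappa%:E * (gauss \x gauss) D)%E.
  move=> mD.
  refine (@measure_unique _ R (RR * RR)%type
    [set A `*` C | A in measurable & C in measurable] (fun=> setT)
    (measurable_prod_measurableType _ _) _ _ _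
    (pushforward (mrestr P mrest) ((fun w => (Z a w, Z b w)) : T -> RR * RR))
    (mscale (NngNum kappa0) (gauss \x gauss)%E) _ _ D mD).
  - move=> _ _ [A mA [C mC <-]] [A' mA' [C' mC' <-]].
    exists (A `&` A'); first exact: measurableI.
    exists (C `&` C'); first exact: measurableI.
    by rewrite setXI.
  - by move=> _; exists setT => //; exists setT => //; rewrite setXTT.
  - by rewrite bigcup_const //; exists 0%N.
  - move=> _ [A mA [C mC <-]]; rewrite /= /pushforward /mrestr /mscale /=.
    by rewrite splitE // product_measure1E.
  - move=> _; rewrite /= /pushforward /mrestr /= (le_lt_trans _ (ltry 1)) //.
    by apply: probability_le1; apply: measurableI => //; rewrite preimage_setT.
rewrite (_ : \bigcap_(i in _) _ =
    [set w | (rot2 c s @^-1` (B a `*` B b)) (Z a w, Z b w)] `&` rest); last first.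
  apply/seteqP; split => w /=.
    move=> h; split; first split.
    - by have := h a Logic.I; rewrite /rotate_pair /= eqxx.
    - by have := h b Logic.I; rewrite /rotate_pair /= eq_sym (negbTE ab) eqxx.
    - move=> i /andP[ia ib]; have := h i Logic.I.
      by rewrite /rotate_pair /= (negbTE ia) (negbTE ib).
  move=> [[/= hA hC] hr] i _; rewrite /rotate_pair /=.
  case: eqP => [->//|/eqP ia]; case: eqP => [->//|/eqP ib].
  by apply: hr; rewrite /= ia ib.
rewrite gaussE; last first.
  rewrite -[X in measurable X]setTI; apply: measurable_rot2 => //.
  by apply: measurableX; exact: mB.
rewrite gauss2_rot2 //; [|exact: mB|exact: mB].
rewrite [in RHS](bigD1 a) //= (bigD1 b) /=; last by rewrite eq_sym.
rewrite mulrA mulrC !EFinM !fineK //.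
- by apply: fin_num_measure; exact: mB.
- by apply: fin_num_measure; exact: mB.
Unshelve. exact: mpair.
Qed.

End GaussianRotation.

Local Notation euclid I := (g_sigma_algebraType (@boxes _ I)).

Section FamilyTransforms.
Context {R : realType} {d : measure_display} {T : measurableType d}.
Variable P : probability T R.
Local Notation gauss := (normal_prob (0 : R) 1).

Lemma gaussian_family_integralE (I : finType) (Z : I -> T -> R)
    d' (T' : measurableType d') (P' : probability T' R) (Z' : I -> T' -> R)
    (G : (I -> R) -> \bar R) :
  gaussian_family P Z -> gaussian_family P' Z' ->
  measurable_fun [set: euclid I] G ->
  (\int[P]_w G (fun i => Z i w) = \int[P']_w G (fun i => Z' i w))%E.
Proof.
move=> gZ gZ' mG; rewrite integralE [RHS]integralE; congr (_ - _)%E.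
- rewrite (funepos_comp G (fun w i => Z i w)) (funepos_comp G (fun w i => Z' i w)).
  exact: (gaussian_family_integral gZ gZ' (measurable_funepos mG) (funepos_ge0 G)).
- rewrite (funeneg_comp G (fun w i => Z i w)) (funeneg_comp G (fun w i => Z' i w)).
  exact: (gaussian_family_integral gZ gZ' (measurable_funeneg mG) (funeneg_ge0 G)).
Qed.

Lemma gaussian_family_sub (I J : finType) (h : J -> I) (Z : I -> T -> R) :
  injective h -> gaussian_family P Z -> gaussian_family P (Z \o h).
Proof.
move=> hinj [mZ lZ]; split => [j|B mB]; first exact: mZ.
pose B' i := if [pick j | h j == i] is Some j then B j else setT.
have B'h j : B' (h j) = B j.
  rewrite /B'; case: pickP => [j' /eqP /hinj -> //|/(_ j)]; by rewrite eqxx.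
have -> : \bigcap_(j in [set: J]) ((Z \o h) j @^-1` B j) =
    \bigcap_(i in [set: I]) (Z i @^-1` B' i).
  apply/seteqP; split => w /= hw i _.
    by rewrite /B' /=; case: pickP => [j /eqP <-|//]; exact: hw.
  by have := hw (h i) Logic.I; rewrite /= B'h.
rewrite lZ => [|i]; last by rewrite /B'; case: pickP => // j _; exact: mB.
congr (_%:E); rewrite (bigID [in codom h]) /= [X in _ * X]big1 ?mulr1; last first.
  move=> i; rewrite /B'; case: pickP => [j /eqP <-|_ _]; first by rewrite codom_f.
  by rewrite probability_setT.
rewrite (eq_bigl [in [set h j | j in [set: J]]]%SET); last first.
  move=> i; apply/idP/imsetP => [/codomP[j ->]|[j _ ->]]; last exact: codom_f.
  by exists j; rewrite ?inE.
rewrite big_imset /=; last by move=> j j' _ _ /hinj.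
by apply: eq_big => [j|j _]; rewrite ?inE ?B'h.
Qed.

Variables (I : finType) (Z : bool * I -> T -> R).

(** [J] holds the coordinates already rotated: the law is preserved by induction on [J], one planar
    rotation at a time, up to [predT]. *)
Definition rotate_pairs (c s : R) (J : {pred I}) (u : bool * I) (w : T) : R :=
  if u.2 \in J then
    let z := rot2 c s (Z (false, u.2) w, Z (true, u.2) w) in
    if u.1 then z.2 else z.1
  else Z u w.

Lemma gaussian_family_rotate_pairs (c s : R) :
  c ^+ 2 + s ^+ 2 = 1 -> s != 0 -> gaussian_family P Z ->
  gaussian_family P (rotate_pairs c s predT).
Proof.
move=> cs s0 gZ.
have gs (l : seq I) : uniq l -> gaussian_family P (rotate_pairs c s [in l]).
  elim: l => [_|j l IH /= /andP[jl /IH {}IH]].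
    by rewrite (_ : rotate_pairs _ _ _ = Z) //; apply/funext => u.
  have ab : (false, j) != (true, j) :> bool * I by [].
  have := gaussian_family_rotate_pair ab cs s0 IH; congr gaussian_family.
  apply/funext => -[b i]; apply/funext => w.
  rewrite /rotate_pair /rotate_pairs /= !inE (negbTE jl) !xpair_eqE /=.
  by have [->|ij] := eqVneq i j; case: b; rewrite ?(negbTE jl).
have := gs (enum I) (enum_uniq I); congr gaussian_family.
by apply/funext => u; rewrite /rotate_pairs; apply/funext => w; rewrite mem_enum.
Qed.

End FamilyTransforms.

Section IndependentCopy.
Context {R : realType} {d : measure_display} {T : measurableType d}.
Variables (P : probability T R) (I : finType) (Z : I -> T -> R).
Hypothesis gZ : gaussian_family P Z.
Local Notation P2 := (P \x P)%E.

Definition copies (u : bool * I) (w : T * T) : R :=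
  Z u.2 (if u.1 then w.2 else w.1).

Lemma gaussian_family_copies : gaussian_family P2 copies.
Proof.
have [mZ lZ] := gZ; split => [[[] i]|B mB] /=.
- by apply: (measurableT_comp (mZ i)).
- by apply: (measurableT_comp (mZ i)).
have -> : \bigcap_(u in [set: bool * I]) (copies u @^-1` B u) =
   (\bigcap_(i in [set: I]) (Z i @^-1` B (false, i))) `*`
   (\bigcap_(i in [set: I]) (Z i @^-1` B (true, i))).
  apply/seteqP; split => w /=.
    by move=> h; split => i _; [exact: (h (false, i))|exact: (h (true, i))].
  by move=> [h0 h1] [[] i] _; [exact: h1|exact: h0].
have mb b : measurable (\bigcap_(i in [set: I]) (Z i @^-1` B (b, i))).
  apply: fin_bigcap_measurable => [|i _]; first exact: finite_finset.
  by rewrite -[X in measurable X]setTI; apply: mZ.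
transitivity (P (\bigcap_(i in [set: I]) (Z i @^-1` B (false, i))) *
  P (\bigcap_(i in [set: I]) (Z i @^-1` B (true, i))))%E.
  by apply: product_measure1E; exact: mb.
have -> := lZ (fun i => B (false, i)) (fun i => mB (false, i)).
have -> := lZ (fun i => B (true, i)) (fun i => mB (true, i)).
rewrite -EFinM; congr (_%:E).
transitivity (\prod_b \prod_i fine (normal_prob (0 : R) 1 (B (b, i)))).
  by rewrite big_bool /= mulrC.
by rewrite pair_bigA /=; apply: eq_bigr => -[].
Qed.

End IndependentCopy.

(** * Moments *)

Section LipschitzMeasurable.
Context {R : realType} {n : nat}.

Lemma ipnorm_le_coord (u : 'rV[R]_n) (e : R) : 0 <= e -> (forall i, `|u 0 i| <= e) ->
  ipnorm u <= e.
Proof.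
move=> e0 h; rewrite ipnorm_le // /ip.
have : \sum_i u 0 i * u 0 i <= \sum_(i < n) e ^+ 2.
  by apply: ler_sum => i _; rewrite -expr2 -real_normK ?num_real // ler_sqr ?nnegrE.
rewrite sumr_const card_ord -[_ *+ n]mulr_natl => le1.
have := ler0n R n; rewrite le_eqVlt => /predU1P[<-|n0].
  by rewrite invr0 mul0r sqr_ge0.
by rewrite ler_pdivrMl.
Qed.

(** Suprema over the possibly uncountable set [K] become measurable this way, being Lipschitz in the
    noise. *)
Lemma measurable_lipschitz d (T : measurableType d) (Z : 'I_n -> T -> R)
    (f : 'rV[R]_n -> R) (L : R) :
  (forall i, measurable_fun [set: T] (Z i)) ->
  (forall x y, `|f x - f y| <= L * ipnorm (x - y)) ->
  measurable_fun [set: T] (fun w => f (\row_i Z i w)).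
Proof.
move=> mZ fL; apply: (measurable_fun_of_continuity mZ) => w e e0.
have L0 : 0 < `|L| + 1 by rewrite ltr_wpDl.
exists (e / (`|L| + 1)) => [|w' h]; first exact: divr_gt0.
apply: (le_lt_trans (fL _ _)).
have : ipnorm (\row_i Z i w - \row_i Z i w') <= e / (`|L| + 1).
  apply: ipnorm_le_coord => [|i]; first by rewrite ltW // divr_gt0.
  by rewrite !mxE ltW.
rewrite ler_pdivlMr // => h1; apply: le_lt_trans (ler_wpM2r (ipnorm_ge0 _) (ler_norm L)) _.
have := ipnorm_ge0 (\row_i Z i w - \row_i Z i w').
move: (ipnorm _) h1 => t h1; rewrite le_eqVlt => /predU1P[<-|t0]; first by rewrite mulr0.
by apply: lt_le_trans h1; rewrite mulrDr mulr1 mulrC ltrDl.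
Qed.

Lemma ip_lipschitz (v x y : 'rV[R]_n) : `|ip x v - ip y v| <= ipnorm v * ipnorm (x - y).
Proof. by rewrite -ipNl -ipDl mulrC ip_norm_le. Qed.

Lemma ipnorm_lipschitz (x y : 'rV[R]_n) : `|ipnorm x - ipnorm y| <= 1 * ipnorm (x - y).
Proof.
have h (a b : 'rV[R]_n) : ipnorm a - ipnorm b <= ipnorm (a - b).
  by rewrite lerBlDr -{1}(subrK b a) ipnormD.
by rewrite mul1r ler_norml h andbT lerNl opprB ipnormB h.
Qed.

End LipschitzMeasurable.

Section Moments.
Context {R : realType}.
Local Notation mu := (@lebesgue_measure R).
Local Notation RR := (measurableTypeR R).
Local Notation gauss := (normal_prob (0 : R) 1).
Local Notation phi := (normal_pdf (0 : R) 1).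
Local Open Scope ereal_scope.

(* Comparing with the density of variance [(1 + t) ^ 2] and using
   [1 + a <= expR a] bounds the second moment by [1 + 2 t]. *)
Lemma gauss_second_moment : \int[gauss]_x (x ^+ 2)%:E <= 1.
Proof.
have msqr : measurable_fun [set: RR] (fun x : RR => (x ^+ 2)%:E : \bar R).
  by apply/measurable_EFinP; exact: measurable_funX.
have mphi : measurable_fun [set: RR] (EFin \o phi).
  by apply/measurable_EFinP; exact: measurable_normal_pdf.
have phi0 x : 0 <= (phi x)%:E by rewrite lee_fin normal_pdf_ge0.
rewrite ge0_integral_normal_prob //; last by move=> x; rewrite lee_fin sqr_ge0.
set M := \int[mu]_x _.
have M0 : 0 <= M by apply: integral_ge0 => x _; rewrite mule_ge0 // lee_fin sqr_ge0.
have key (t : R) : (0 < t)%R -> M <= (1 + 2 * t)%:E.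
  move=> t0; pose s := (1 + t)%R; have s0 : (0 < s)%R by rewrite /s; lra.
  (* This [a] makes [phi x * expR (a * x ^+ 2)] equal to [s] times the density of standard deviation
     [s]. Integrating [1 + a x^2 <= expR (a x^2)] against [phi] gives [1 + a M <= s], that is
     [a M <= t]. *)
  pose a := ((1 - s ^- 2) / 2)%R.
  have a0 : (0 < a)%R.
    rewrite /a divr_gt0 // subr_gt0 invf_lt1 ?exprn_gt0 // exprn_egt1 // /s; lra.
  have pdfE x : (s * normal_pdf 0 s x =
      (Num.sqrt (pi *+ 2))^-1 * expR (- (x ^+ 2 / 2)) * expR (a * x ^+ 2))%R.
    rewrite normal_pdfE ?gt_eqF // /normal_peak /normal_fun subr0 -mulrnAr.
    rewrite sqrtrM ?sqr_ge0 // sqrtr_sqr ger0_norm ?ltW // invfM !mulrA.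
    rewrite divff ?gt_eqF // mul1r -mulrA -expRD; congr (_ * expR _)%R.
    by rewrite /a; field; rewrite gt_eqF.
  have sqp x : 0 <= (x ^+ 2)%:E * (phi x)%:E by rewrite mule_ge0 // lee_fin sqr_ge0.
  have ap : 0 <= a%:E by rewrite lee_fin ltW.
  have le1 : \int[mu]_x ((phi x)%:E + a%:E * ((x ^+ 2)%:E * (phi x)%:E)) <=
             \int[mu]_x (s%:E * (normal_pdf 0 s x)%:E).
    apply: ge0_le_integral => //.
    - by move=> x _; rewrite adde_ge0 // mule_ge0.
    - apply: emeasurable_funD => //; apply: emeasurable_funM => //.
      exact: emeasurable_funM.
    - by apply: emeasurable_funM => //; apply/measurable_EFinP; exact: measurable_normal_pdf.
    move=> x _; rewrite -!EFinM -EFinD lee_fin pdfE normal_pdf01E.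
    set p := (_ * expR (- _))%R.
    have -> : (p + a * (x ^+ 2 * p) = p * (1 + a * x ^+ 2))%R by ring.
    by rewrite ler_wpM2l ?expR_ge1Dx // mulr_ge0 ?invr_ge0 ?sqrtr_ge0 ?expR_ge0.
  rewrite ge0_integralD // in le1; last 2 first.
  - by move=> x _; rewrite mule_ge0.
  - by apply: emeasurable_funM => //; exact: emeasurable_funM.
  rewrite integral_normal_pdf ge0_integralZl // in le1; last first.
    exact: emeasurable_funM.
  rewrite ge0_integralZl // in le1; last 3 first.
  - by apply/measurable_EFinP; exact: measurable_normal_pdf.
  - by move=> x _; rewrite lee_fin normal_pdf_ge0.
  - by rewrite lee_fin ltW.
  rewrite integral_normal_pdf mule1 -/M in le1.
  case: M M0 le1 => [m m0||] //=; last by rewrite gt0_muley ?lte_fin // addey.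
  rewrite -EFinM -EFinD !lee_fin => le1.
  have : (a * m <= a * (1 + 2 * t))%R.
    apply: (@le_trans _ _ t); first by rewrite /s in le1; lra.
    rewrite -(ler_pM2l (exprn_gt0 2 s0)).
    have -> : (s ^+ 2 * (a * (1 + 2 * t)) = (s ^+ 2 - 1) / 2 * (1 + 2 * t))%R.
      by rewrite /a; field; rewrite gt_eqF.
    by rewrite /s; nra.
  by rewrite ler_pM2l.
apply/lee_addgt0Pr => e e0; rewrite -EFinD.
by have := key (e / 2)%R; rewrite divr_gt0 // => /(_ isT); rewrite mulrCA divff ?mulr1.
Qed.

End Moments.

Section GaussianVector.
Context {R : realType} {d : measure_display} {T : measurableType d}.
Variables (P : probability T R) (n : nat) (Z : 'I_n -> T -> R).
Hypothesis gZ : gaussian_family P Z.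
Local Notation gauss := (normal_prob (0 : R) 1).
Local Notation RR := (measurableTypeR R).
Local Open Scope ereal_scope.
Local Notation xv w := (\row_i Z i w).

Let mZ i : measurable_fun [set: T] (Z i). Proof. exact: gZ.1. Qed.

Lemma gaussian_family_id : gaussian_family gauss (fun (_ : unit) (x : RR) => x : R).
Proof.
split => // B mB; rewrite (_ : \bigcap_(i in _) _ = B tt); last first.
  by apply/seteqP; split => x /= => [/(_ tt)|? []//]; exact.
rewrite (big_pred1 tt) => [|[]//].
by rewrite fineK //; apply: fin_num_measure; exact: mB.
Qed.

Lemma gaussian_second_moment i : \int[P]_w (Z i w ^+ 2)%:E <= 1.
Proof.
have gi := @gaussian_family_sub _ _ _ P _ unit (fun=> i) Z.
rewrite (le_trans _ (@gauss_second_moment R)) //.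
have mG : measurable_fun [set: euclid unit] (fun y : unit -> R => (y tt ^+ 2)%:E).
  apply/measurable_EFinP; apply: measurable_funX; exact: measurable_coord.
rewrite -(gaussian_family_integralE (gi _ gZ) gaussian_family_id mG) //.
by move=> [] [].
Qed.

Lemma integrable_gaussian_sqr i : P.-integrable [set: T] (fun w => (Z i w ^+ 2)%:E).
Proof.
apply/integrableP; split.
  by apply/measurable_EFinP; exact: measurable_funX.
under eq_integral do rewrite gee0_abs ?lee_fin ?sqr_ge0 //.
by rewrite (le_lt_trans (gaussian_second_moment i)) ?ltry.
Qed.

Lemma integrable_gaussian_mul i j :
  P.-integrable [set: T] (fun w => (Z i w * Z j w)%:E).
Proof.
apply: (le_integrable _ _ _ (integrableD measurableT (integrable_gaussian_sqr i)
  (integrable_gaussian_sqr j))) => //.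
  by apply/measurable_EFinP; exact: measurable_funM.
move=> w _; rewrite /= !lee_fin [leRHS]ger0_norm ?addr_ge0 ?sqr_ge0 //.
rewrite ler_norml; apply/andP; split.
- have := sqr_ge0 (Z i w + Z j w); have := sqr_ge0 (Z i w); have := sqr_ge0 (Z j w).
  by lra.
- have := sqr_ge0 (Z i w - Z j w); have := sqr_ge0 (Z i w); have := sqr_ge0 (Z j w).
  by lra.
Qed.

(* Rotating the pair [(i, j)] by a right angle changes the sign of the product. *)
Lemma gaussian_covariance i j : i != j -> \int[P]_w (Z i w * Z j w)%:E = 0.
Proof.
move=> ij; have cs : (0 ^+ 2 + 1 ^+ 2 = 1 :> R)%R by rewrite expr0n expr1n add0r.
have gr := gaussian_family_rotate_pair ij cs (oner_neq0 R) gZ.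
have mG : measurable_fun [set: euclid 'I_n] (fun y : 'I_n -> R => (y i * y j)%:E).
  by apply/measurable_EFinP; apply: measurable_funM; exact: measurable_coord.
have := gaussian_family_integralE gZ gr mG.
rewrite [X in _ = X -> _](eq_integral (fun w => (- 1)%:E * (Z i w * Z j w)%:E)); last first.
  move=> w _; rewrite /rotate_pair !eqxx eq_sym (negbTE ij) -EFinM /rot2 /=.
  by congr EFin; ring.
rewrite integralZl //; last exact: integrable_gaussian_mul.
have := integrable_fin_num measurableT (integrable_gaussian_mul i j).
case: (\int[P]_w _) => // r _ [] h; congr EFin; lra.
Qed.

Lemma measurable_gaussian_ip v : measurable_fun [set: T] (fun w => ip (xv w) v).
Proof. exact: (measurable_lipschitz mZ (ip_lipschitz v)). Qed.

(** Off-diagonal covariances vanish, so the squared normalization [n^-2] is met by a single sum. The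
    factor [n^-1] left over is the source of the [1 / n] in the variance bound. *)
Lemma gaussian_ip_sqr (v : 'rV[R]_n) :
  \int[P]_w (ip (xv w) v ^+ 2)%:E <= (n%:R^-1 * ip v v)%:E.
Proof.
pose F i j w := (n%:R^-1 ^+ 2 * (v 0 i * v 0 j))%:E * (Z i w * Z j w)%:E.
have iF i j : P.-integrable [set: T] (F i j).
  by apply: integrableZl => //; exact: integrable_gaussian_mul.
rewrite (eq_integral (fun w => \sum_i \sum_j F i j w)); last first.
  move=> w _; rewrite /ip exprMn [X in (_ * X)%R]expr2 big_distrlr /= mulr_sumr -sumEFin.
  apply: eq_bigr => i _; rewrite mulr_sumr -sumEFin; apply: eq_bigr => j _.
  by rewrite /F -EFinM !mxE; congr EFin; ring.
rewrite integral_sum //; last first.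
  by move=> i; apply: integrable_sum => // j _; exact: iF.
rewrite /ip !mulr_sumr -sumEFin; apply: lee_sum => i _.
rewrite integral_sum // (bigD1 i) //= big1 ?adde0.
  rewrite /F integralZl //; last exact: integrable_gaussian_mul.
  rewrite -[leRHS]mule1 -expr2 expr2 -mulrA mulrA -expr2.
  apply: lee_wpmul2l; first by rewrite lee_fin mulr_ge0 ?sqr_ge0 // -expr2 sqr_ge0.
  by under eq_integral do rewrite -expr2; exact: gaussian_second_moment.
move=> j ji; rewrite /F integralZl //; last exact: integrable_gaussian_mul.
by rewrite gaussian_covariance ?mule0 // eq_sym.
Qed.

Lemma gaussian_ip_self : \int[P]_w (ip (xv w) (xv w))%:E <= 1.
Proof.
rewrite (eq_integral (fun w => (n%:R^-1)%:E * \sum_i (Z i w ^+ 2)%:E)); last first.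
  move=> w _; rewrite /ip EFinM -sumEFin; congr (_ * _).
  by apply: eq_bigr => i _; rewrite !mxE expr2.
have m2 i : measurable_fun [set: T] (fun w => (Z i w ^+ 2)%:E).
  by apply/measurable_EFinP; exact: measurable_funX.
rewrite ge0_integralZl //; last 2 first.
- exact: emeasurable_sum.
- by move=> w _; apply: sume_ge0 => i _; rewrite lee_fin sqr_ge0.
rewrite ge0_integral_sum //; last by move=> i w _; rewrite lee_fin sqr_ge0.
have : \sum_i \int[P]_w (Z i w ^+ 2)%:E <= n%:R%:E.
  rewrite (@le_trans _ _ (\sum_(i < n) 1)) //.
    by apply: lee_sum => i _; exact: gaussian_second_moment.
  by rewrite sumEFin sumr_const card_ord.
have n0 : 0 <= n%:R^-1%:E :> \bar R by rewrite lee_fin invr_ge0.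
move=> /(lee_wpmul2l n0) /le_trans; apply; rewrite -EFinM lee_fin.
have := ler0n R n; rewrite le_eqVlt => /predU1P[<-|np]; first by rewrite mulr0.
by rewrite mulVf // gt_eqF.
Qed.

Lemma measurable_gaussian_ip_self : measurable_fun [set: T] (fun w => ip (xv w) (xv w)).
Proof.
under eq_fun do rewrite -ipnorm_sqr.
by apply: measurable_funX; exact: (measurable_lipschitz mZ ipnorm_lipschitz).
Qed.

Lemma integrable_gaussian_ip_self :
  P.-integrable [set: T] (fun w => (ip (xv w) (xv w))%:E).
Proof.
apply/integrableP; split.
  by apply/measurable_EFinP; exact: measurable_gaussian_ip_self.
under eq_integral do rewrite gee0_abs ?lee_fin ?ip_ge0 //.
by rewrite (le_lt_trans gaussian_ip_self) ?ltry.
Qed.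

Lemma integrable_gaussian_dominated (f : T -> R) (a b : R) :
  measurable_fun [set: T] f ->
  (forall w, `|f w| <= a + b * ip (xv w) (xv w))%R ->
  P.-integrable [set: T] (EFin \o f).
Proof.
move=> mf fab.
have := integrableD measurableT
  (@finite_measure_integrable_cst _ _ _ P _ a measurableT)
  (integrableZl measurableT b integrable_gaussian_ip_self).
apply: le_integrable => //; first exact/measurable_EFinP.
by move=> w _; rewrite /= lee_fin (le_trans (fab w)) // ler_norm.
Qed.

Lemma integrable_gaussian_ip v : P.-integrable [set: T] (fun w => (ip (xv w) v)%:E).
Proof.
apply: (@integrable_gaussian_dominated _ (ip v v) 1).
  exact: measurable_gaussian_ip.
move=> w; rewrite mul1r; apply: le_trans (ip_norm_le _ _) _; rewrite -!ipnorm_sqr.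
have := sqr_ge0 (ipnorm (xv w) - ipnorm v); have := ipnorm_ge0 v; have := ipnorm_ge0 (xv w).
by move: (ipnorm _) (ipnorm _) => p q; nra.
Qed.

End GaussianVector.

Section RotatedCopies.
Context {R : realType} {d : measure_display} {T : measurableType d}.
Variables (P : probability T R) (n : nat) (Z : 'I_n -> T -> R).
Hypothesis gZ : gaussian_family P Z.
Local Open Scope ereal_scope.

Lemma gaussian_family_rotated (c s : R) : (c ^+ 2 + s ^+ 2 = 1)%R -> s != 0%R ->
  gaussian_family (P \x P) (rotate_pairs (copies Z) c s predT).
Proof.
by move=> cs s0; apply: gaussian_family_rotate_pairs => //; exact: gaussian_family_copies.
Qed.

Lemma measurable_euclid_ip (v : 'rV[R]_n) :
  measurable_fun [set: euclid 'I_n] (fun y : 'I_n -> R => (ip (\row_i y i) v)%:E).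
Proof.
apply/measurable_EFinP.
exact: (measurable_lipschitz (T := euclid 'I_n) (@measurable_coord R 'I_n) (ip_lipschitz v)).
Qed.

(** A quarter turn sends [(xi, xi')] to [(xi', - xi)], so [- xi] has the law of [xi] and the mean
    equals its own opposite. *)
Lemma gaussian_ip_centered v : \int[P]_w (ip (\row_i Z i w) v)%:E = 0.
Proof.
have cs : (0 ^+ 2 + 1 ^+ 2 = 1 :> R)%R by rewrite expr0n expr1n add0r.
have inj (b : bool) : injective (fun i : 'I_n => (b, i)) by move=> i j [].
have g1 := gaussian_family_sub (inj true) (gaussian_family_rotated cs (oner_neq0 R)).
have g2 := gaussian_family_sub (inj false) (gaussian_family_copies gZ).
have e1 := gaussian_family_integralE gZ g1 (measurable_euclid_ip v).
have e2 := gaussian_family_integralE gZ g2 (measurable_euclid_ip v).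
have fin := integrable_fin_num measurableT (integrable_gaussian_ip gZ v).
rewrite (eq_integral (fun w => (- 1)%:E * (ip (\row_i (copies Z \o pair false) i w) v)%:E)) in e1;
    last first.
  move=> w _; rewrite -EFinM mulN1r -ipNl; congr ((ip _ _)%:E).
  by apply/rowP => i; rewrite !mxE /rotate_pairs /rot2 /copies /= mul0r mul1r sub0r.
rewrite integralZl // in e1; last exact: integrable_gaussian_ip g2 v.
move: e1; rewrite -e2.
case: (\int[P]_w _) fin => // r _ [] h; congr EFin; lra.
Qed.

End RotatedCopies.

(** * Variance of the support function *)

Section TrigBounds.
Import numFieldNormedType.Exports.
Context {R : realType}.
Implicit Types x : R.

Lemma sin_le x : 0 < x -> sin x <= x.
Proof.
move=> x0.
have [|c _] := @MVT R (@sin R) cos 0 x x0 (fun y _ => is_derive_sin y).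
  exact/continuous_subspaceT/continuous_sin.
by rewrite sin0 !subr0 => ->; rewrite -[leRHS]mul1r ler_wpM2r ?cos_le1 // ltW.
Qed.

Lemma cos_ge x : 0 < x < pi -> 1 - x ^+ 2 / 2 <= cos x.
Proof.
move=> /andP[x0 xpi].
have h0 : 0 < x / 2 by rewrite divr_gt0.
have : sin (x / 2) ^+ 2 <= (x / 2) ^+ 2.
  rewrite ler_sqr ?nnegrE ?sin_le ?ltW // sin_gt0_pi // h0 /=; lra.
rewrite (_ : cos x = 1 - 2 * sin (x / 2) ^+ 2).
  by rewrite exprMn; lra.
rewrite {1}(_ : x = (x / 2) *+ 2); last by rewrite -mulr_natr; field.
by rewrite cos_mulr2n cos2sin2 -[_ *+ 2]mulr_natr; ring.
Qed.

End TrigBounds.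

Lemma integral_prob_cst (R : realType) d (T : measurableType d)
    (P : probability T R) (k : R) : (\int[P]_w k%:E = k%:E)%E.
Proof.
exact: etrans (integral_cst P measurableT k%:E)
  (etrans (congr1 (mule k%:E) (probability_setT P)) (mule1 _)).
Qed.

Lemma ge0_integral_le_2D (R : realType) d (T : measurableType d)
    (m : {measure set T -> \bar R}) (f g h : T -> R) :
  measurable_fun [set: T] f -> measurable_fun [set: T] g -> measurable_fun [set: T] h ->
  (forall w, 0 <= f w) -> (forall w, 0 <= g w) -> (forall w, 0 <= h w) ->
  (forall w, f w <= 2 * g w + 2 * h w) ->
  (\int[m]_w (f w)%:E <= 2%:E * \int[m]_w (g w)%:E + 2%:E * \int[m]_w (h w)%:E)%E.
Proof.
move=> /measurable_EFinP mf /measurable_EFinP mg /measurable_EFinP mh f0 g0 h0 le.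
rewrite -!ge0_integralZl ?lee_fin //; last 2 first.
- by move=> w _; rewrite lee_fin.
- by move=> w _; rewrite lee_fin.
rewrite -ge0_integralD //; last 4 first.
- by move=> w _; rewrite mule_ge0 // lee_fin.
- exact: emeasurable_funM.
- by move=> w _; rewrite mule_ge0 // lee_fin.
- exact: emeasurable_funM.
apply: ge0_le_integral => //.
- by move=> w _; rewrite lee_fin.
- by apply: emeasurable_funD; apply: emeasurable_funM.
- by move=> w _; rewrite -!EFinM -EFinD lee_fin.
Qed.

(** * Change of the support function under rotation of the noise *)

Section Variance.
Context {R : realType} {d : measure_display} {T : measurableType d}.
Variables (P : probability T R) (n : nat) (Z : 'I_n -> T -> R).
Hypothesis gZ : gaussian_family P Z.
Hypothesis n0 : (0 < n)%N.
Variable K : set 'rV[R]_n.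
Hypothesis K0 : K 0.
Variable r : R.
Hypothesis r0 : 0 < r.
Local Notation RR := (measurableTypeR R).
Local Open Scope ereal_scope.
Local Notation xv w := (\row_i Z i w).
Local Notation P2 := (P \x P).
Local Notation H := (ksup K r).

Definition lin2 (a b : R) (y : bool * 'I_n -> R) : 'rV[R]_n :=
  \row_i (a * y (false, i) + b * y (true, i))%R.

Definition copy w (u : bool * 'I_n) : R := copies Z u w.

Lemma lin2_copies a b w :
  lin2 a b (copy w) = (a *: xv w.1 + b *: xv w.2)%R.
Proof. by apply/rowP => i; rewrite !mxE. Qed.

(** With [phi = sqr] and coefficients [1], [0], [cos th], [sin th] this is the [V th] of the
    overview. Both arguments are left free so that rotation invariance can be stated. *)
Definition rotation_energy (phi : R -> R) (a b a' b' : R) :=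
  \int[P2]_w (phi (H (lin2 a b (copy w)) - H (lin2 a' b' (copy w)))%R)%:E.

Lemma measurable_ksup_lin2 (d' : measure_display) (T' : measurableType d')
  (Y : bool * 'I_n -> T' -> R) (a b : R) :
  (forall u, measurable_fun [set: T'] (Y u)) ->
  measurable_fun [set: T'] (fun w => H (lin2 a b (fun u => Y u w))).
Proof.
move=> mY.
apply: (@measurable_lipschitz _ _ _ _
  (fun i w => a * Y (false, i) w + b * Y (true, i) w)%R H r).
  by move=> i; apply: measurable_funD; apply: measurable_funM.
by move=> x y; apply: (ksup_lipschitz K0); exact: ltW.
Qed.

(** Both arguments are read off the same pair [(xi, xi')], whose law is unchanged when it is
    rotated. *)
Lemma rot_diff_rotate (phi : R -> R) (a b a' b' c s : R) :
  (c ^+ 2 + s ^+ 2 = 1)%R -> s != 0%R -> measurable_fun [set: RR] phi ->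
  rotation_energy phi a b a' b' =
  rotation_energy phi (a * c - b * s) (a * s + b * c) (a' * c - b' * s) (a' * s + b' * c).
Proof.
move=> cs s0 mphi.
have mG : measurable_fun [set: euclid (bool * 'I_n)%type]
    (fun y : bool * 'I_n -> R => (phi (H (lin2 a b y) - H (lin2 a' b' y))%R)%:E).
  apply/measurable_EFinP; apply: (measurableT_comp mphi).
  by apply: measurable_funB; apply: (@measurable_ksup_lin2 _
    (euclid (bool * 'I_n)%type) (fun u y => y u)) => u; exact: measurable_coord.
have := gaussian_family_integralE (gaussian_family_copies gZ)
  (gaussian_family_rotated gZ cs s0) mG.
rewrite /rotation_energy => ->; apply: eq_integral => w _.
by congr ((phi (H _ - H _)%R)%:E); apply/rowP => i;
  rewrite !mxE /copy /rotate_pairs /rot2 /=; ring.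
Qed.

Lemma measurable_rot_diff (phi : R -> R) (a b a' b' : R) : measurable_fun [set: RR] phi ->
  measurable_fun [set: T * T]
    (fun w => (phi (H (lin2 a b (copy w)) - H (lin2 a' b' (copy w)))%R)%:E).
Proof.
move=> mphi; apply/measurable_EFinP; apply: (measurableT_comp mphi).
have [mc _] := gaussian_family_copies gZ.
by apply: measurable_funB; exact: measurable_ksup_lin2.
Qed.

(** A near-maximizer for [xi] bounds [H xi - H xi_th] from above only, hence the one-sided
    square. *)
Definition sqr_pos (x : R) : R := (Num.max 0 x ^+ 2)%R.
Definition sqr (x : R) : R := (x ^+ 2)%R.

Lemma measurable_sqr : measurable_fun [set: RR] sqr.
Proof. exact: measurable_funX. Qed.

Lemma measurable_sqr_pos : measurable_fun [set: RR] sqr_pos.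
Proof. by apply: measurable_funX; apply: measurable_maxr. Qed.

Lemma sqr_split x : (sqr x = sqr_pos x + sqr_pos (- x))%R.
Proof.
rewrite /sqr /sqr_pos; case: (lerP 0 x) => x0.
  by rewrite (max_l (y := - x)%R) ?oppr_le0 // expr0n addr0.
by rewrite max_r ?sqrrN ?expr0n ?add0r // oppr_ge0 ltW.
Qed.

(** A near-maximizer [v] for [xi] gives [H xi - H xi_th <= e + (1 - c) <xi, v> - s <xi', v>]. It is
    chosen with [xi] fixed and [xi'] is integrated first, so [<xi', v>] has second moment at most
    [r^2 / n]. Since [v] depends on [xi], only the crude bound [|xi| r] is used for [<xi, v>]; its
    coefficient [1 - c] is of second order in the angle. *)
Lemma rot_diff_pos_le (c s e : R) : (0 < e)%R ->
  rotation_energy sqr_pos 1 0 c s <=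
  (3 * e ^+ 2 + 3 * (1 - c) ^+ 2 * r ^+ 2 + 3 * s ^+ 2 * (n%:R^-1 * r ^+ 2))%:E.
Proof.
move=> e0; rewrite /rotation_energy fubini_tonelli1; last 2 first.
- by apply: measurable_rot_diff; exact: measurable_sqr_pos.
- by move=> w; rewrite lee_fin sqr_ge0.
pose A w := (3 * e ^+ 2 + 3 * s ^+ 2 * (n%:R^-1 * r ^+ 2) +
  3 * (1 - c) ^+ 2 * r ^+ 2 * ip (xv w) (xv w))%R.
have inner w : fubini_F P (fun w => (sqr_pos (H (lin2 1 0 (copy w)) -
    H (lin2 c s (copy w)))%R)%:E) w <= (A w)%:E.
  rewrite /fubini_F.
  have [v [Kv vr hv]] := ksup_adherent K0 (xv w) (ltW r0) e0.
  pose b := (3 * e ^+ 2 + 3 * (1 - c) ^+ 2 * r ^+ 2 * ip (xv w) (xv w))%R.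
  have vv : (ip v v <= r ^+ 2)%R by rewrite -ipnorm_le // ltW.
  have mi : measurable_fun [set: T] (fun w2 => (ip (xv w2) v ^+ 2)%:E).
    by apply/measurable_EFinP; apply: measurable_funX; exact: (measurable_gaussian_ip gZ).
  apply: (@le_trans _ _ (\int[P]_w2 (b%:E + (3 * s ^+ 2)%:E * (ip (xv w2) v ^+ 2)%:E))).
    apply: ge0_le_integral => //.
    - by move=> w2 _; rewrite lee_fin sqr_ge0.
    - have := measurable_rot_diff 1 0 c s measurable_sqr_pos.
      by move=> h; apply: (measurableT_comp h); exact: pair1_measurable.
    - by apply: emeasurable_funD => //; apply: emeasurable_funM.
    move=> w2 _; rewrite -EFinM -EFinD lee_fin !lin2_copies /= scale1r scale0r addr0.
    have h := ksup_ub K0 (c *: xv w + s *: xv w2)%R Kv vr.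
    rewrite !ipE in h; move: hv.
    have : (ip (xv w) v ^+ 2 <= r ^+ 2 * ip (xv w) (xv w))%R.
      rewrite -(real_normK (num_real (ip (xv w) v))).
      rewrite (le_trans (y := (ipnorm (xv w) * ipnorm v) ^+ 2)%R) //.
        by rewrite ler_sqr ?nnegrE ?mulr_ge0 ?ipnorm_ge0 // ip_norm_le.
      by rewrite exprMn !ipnorm_sqr mulrC ler_wpM2r ?ip_ge0.
    move: h; rewrite /b /sqr_pos; set X := ip (xv w) v; set Y := ip (xv w2) v.
    set Q := (r ^+ 2 * _)%R => h hQ hv.
    have : (Num.max 0 (H (xv w) - H (c *: xv w + s *: xv w2)) ^+ 2 <=
            (e + (1 - c) * X - s * Y) ^+ 2)%R.
      rewrite -(real_normK (num_real (e + (1 - c) * X - s * Y)%R)).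
      rewrite ler_sqr ?nnegrE ?le_max ?lexx // ge_max normr_ge0 /=.
      by apply: (le_trans _ (ler_norm _)); lra.
    move=> /le_trans; apply.
    have := sqr_ge0 (e - (1 - c) * X)%R; have := sqr_ge0 (e + s * Y)%R.
    have := sqr_ge0 ((1 - c) * X + s * Y)%R.
    have : ((1 - c) ^+ 2 * X ^+ 2 <= (1 - c) ^+ 2 * Q)%R by rewrite ler_wpM2l ?sqr_ge0.
    rewrite -(mulrA _ (r ^+ 2)%R) -/Q; nra.
  have b0 : (0 <= b)%R.
    have := mulr_ge0 (sqr_ge0 ((1 - c) * r)) (ip_ge0 (xv w)); have := sqr_ge0 e.
    by rewrite /b exprMn; lra.
  have s3 : (0 <= 3 * s ^+ 2)%R by have := sqr_ge0 s; lra.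
  rewrite ge0_integralD //; last 2 first.
  - by move=> w2 _; rewrite mule_ge0 // lee_fin // sqr_ge0.
  - exact: emeasurable_funM.
  rewrite integral_prob_cst ge0_integralZl //; last first.
    by move=> w2 _; rewrite lee_fin sqr_ge0.
  apply: (@le_trans _ _ (b%:E + (3 * s ^+ 2)%:E * (n%:R^-1 * ip v v)%:E)).
    by rewrite leeD2l // lee_wpmul2l ?lee_fin // gaussian_ip_sqr.
  rewrite -EFinM -EFinD lee_fin /A /b.
  have : (3 * s ^+ 2 * (n%:R^-1 * ip v v) <= 3 * s ^+ 2 * (n%:R^-1 * r ^+ 2))%R.
    by rewrite !ler_wpM2l // invr_ge0.
  lra.
pose k := (3 * e ^+ 2 + 3 * s ^+ 2 * (n%:R^-1 * r ^+ 2))%R.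
pose l := (3 * (1 - c) ^+ 2 * r ^+ 2)%R.
have ni : (0 <= n%:R^-1 :> R)%R by rewrite invr_ge0.
have k0 : (0 <= k)%R.
  have := mulr_ge0 (sqr_ge0 (s * r)) ni; have := sqr_ge0 e.
  by rewrite /k exprMn; lra.
have l0 : (0 <= l)%R by have := sqr_ge0 ((1 - c) * r); rewrite /l exprMn; lra.
have mi : measurable_fun [set: T] (fun w => (ip (xv w) (xv w))%:E).
  by apply/measurable_EFinP; exact: (measurable_gaussian_ip_self gZ).
apply: (@le_trans _ _ (\int[P]_w (k%:E + l%:E * (ip (xv w) (xv w))%:E))).
  apply: ge0_le_integral => //.
  - by move=> w _; apply: integral_ge0 => w2 _; rewrite lee_fin sqr_ge0.
  - apply: measurable_fun_fubini_tonelli_F => //.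
    + by apply: measurable_rot_diff; exact: measurable_sqr_pos.
    + by move=> w; rewrite lee_fin sqr_ge0.
  - by apply: emeasurable_funD => //; apply: emeasurable_funM.
rewrite ge0_integralD //; last 2 first.
- by move=> w _; rewrite mule_ge0 // lee_fin // ip_ge0.
- exact: emeasurable_funM.
rewrite integral_prob_cst ge0_integralZl //; last first.
  by move=> w _; rewrite lee_fin ip_ge0.
apply: (@le_trans _ _ (k%:E + l%:E * 1)).
  by rewrite leeD2l // lee_wpmul2l ?lee_fin // gaussian_ip_self.
by rewrite mule1 -EFinD lee_fin /k /l; lra.
Qed.

Lemma ge0_rot_diff (phi : R -> R) (a b a' b' : R) :
  (forall x, 0 <= phi x)%R -> 0 <= rotation_energy phi a b a' b'.
Proof. by move=> h; apply: integral_ge0 => w _; rewrite lee_fin. Qed.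

(** The one-sided part with [xi] and [xi_th] exchanged becomes, after a rotation of the pair, the
    first one with [- s] in place of [s]. *)
Lemma rot_diff_small (c s : R) : (c ^+ 2 + s ^+ 2 = 1)%R -> (0 < s)%R ->
  rotation_energy sqr 1 0 c s <=
  (6 * ((1 - c) ^+ 2 * r ^+ 2 + 2 * s ^+ 2 * (n%:R^-1 * r ^+ 2)))%:E.
Proof.
move=> cs s0.
have np : (0 < n%:R :> R)%R by rewrite ltr0n.
(* Slack for the near-maximizers: [t ^+ 2] equals [s^2 r^2 / n], so non-attainment only doubles that
   term. *)
pose t := (s * r * Num.sqrt n%:R^-1)%R.
have t0 : (0 < t)%R by rewrite /t !mulr_gt0 // sqrtr_gt0 invr_gt0.
have t2 : (t ^+ 2 = s ^+ 2 * (n%:R^-1 * r ^+ 2))%R.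
  by rewrite /t exprMn sqr_sqrtr ?invr_ge0 // exprMn; ring.
have sN0 : (- s != 0)%R by rewrite oppr_eq0 gt_eqF.
have cs' : (c ^+ 2 + (- s) ^+ 2 = 1)%R by rewrite sqrrN.
have mp (a b a' b' : R) := measurable_rot_diff a b a' b' measurable_sqr_pos.
have -> : rotation_energy sqr 1 0 c s =
    rotation_energy sqr_pos 1 0 c s + rotation_energy sqr_pos c s 1 0.
  rewrite /rotation_energy -ge0_integralD //.
  - by apply: eq_integral => w _; rewrite sqr_split opprB EFinD.
  - by move=> w _; rewrite lee_fin sqr_ge0.
  - by move=> w _; rewrite lee_fin sqr_ge0.
rewrite [X in _ + X](rot_diff_rotate _ _ _ _ cs' sN0 measurable_sqr_pos).
have -> : (c * c - s * - s = 1)%R by rewrite mulrN opprK -!expr2.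
have -> : (c * - s + s * c = 0)%R by ring.
have -> : (1 * c - 0 * - s = c)%R by ring.
have -> : (1 * - s + 0 * c = - s)%R by ring.
apply: (le_trans (leeD (rot_diff_pos_le c s t0) (rot_diff_pos_le c (- s) t0))).
by rewrite -EFinD lee_fin sqrrN t2; lra.
Qed.

(** The increments of [H] from angle 0 to [th] and from [th] to [2 th] have the same law, and the
    square of their sum is at most twice the sum of their squares. *)
Lemma rot_diff_double (c s : R) : (c ^+ 2 + s ^+ 2 = 1)%R -> s != 0%R ->
  rotation_energy sqr 1 0 (c ^+ 2 - s ^+ 2) (2 * c * s) <=
  4%:E * rotation_energy sqr 1 0 c s.
Proof.
move=> cs s0.
have m (a b a' b' : R) := measurable_rot_diff a b a' b' measurable_sqr.
have rotE : rotation_energy sqr 1 0 c s =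
    rotation_energy sqr c s (c ^+ 2 - s ^+ 2) (2 * c * s).
  rewrite (rot_diff_rotate _ _ _ _ cs s0 measurable_sqr).
  have -> : (1 * c - 0 * s = c)%R by ring.
  have -> : (1 * s + 0 * c = s)%R by ring.
  have -> : (c * c - s * s = c ^+ 2 - s ^+ 2)%R by ring.
  by have -> : (c * s + s * c = 2 * c * s)%R by ring.
have sq0 x : (0 <= sqr x)%R by exact: sqr_ge0.
have -> : 4%:E * rotation_energy sqr 1 0 c s = 2%:E * rotation_energy sqr 1 0 c s +
    2%:E * rotation_energy sqr c s (c ^+ 2 - s ^+ 2) (2 * c * s).
  have p : 0 <= rotation_energy sqr 1 0 c s by exact: ge0_rot_diff.
  rewrite -rotE -ge0_muleDl ?lee_fin // -EFinD; congr (_%:E * _); ring.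
rewrite /rotation_energy; apply: ge0_integral_le_2D => [|||w|w|w|w]; try exact: sq0.
- by apply/measurable_EFinP; exact: m.
- by apply/measurable_EFinP; exact: m.
- by apply/measurable_EFinP; exact: m.
rewrite /sqr; move: (H _) (H _) (H _) => x y z.
by have := sqr_ge0 (z - 2 * x + y)%R; lra.
Qed.

End Variance.

(** * Variance bound from repeated halving of the angle *)

Section Variance.
Context {R : realType} {d : measure_display} {T : measurableType d}.
Variables (P : probability T R) (n : nat) (Z : 'I_n -> T -> R).
Hypothesis gZ : gaussian_family P Z.
Hypothesis n0 : (0 < n)%N.
Variable K : set 'rV[R]_n.
Hypothesis K0 : K 0.
Variable r : R.
Hypothesis r0 : 0 < r.
Local Notation RR := (measurableTypeR R).
Local Open Scope ereal_scope.
Local Notation xv w := (\row_i Z i w).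
Local Notation P2 := (P \x P).
Local Notation H := (ksup K r).

Local Notation rot_diff := (rotation_energy P Z K r).
Local Notation sqr := (@sqr R).

(** At the angle [pi / 2] the rotated noise is the independent copy itself. Halving the angle costs
    a factor 4 each time, which the squared sine compensates. *)
Lemma rot_diff_quarter_turn :
  rot_diff sqr 1 0 0 1 <= (72 * (n%:R^-1 * r ^+ 2))%:E.
Proof.
pose th k : R := (pi / 2 / 2 ^+ k)%R.
have p2 k : (0 < 2 ^+ k :> R)%R by rewrite exprn_gt0.
have th0 k : (0 < th k)%R by rewrite /th !divr_gt0 // pi_gt0.
have thpi k : (th k < pi)%R.
  have p1 : (1 <= 2 ^+ k :> R)%R by rewrite exprn_ege1 // ler1n.
  rewrite /th ltr_pdivrMr //; have := pi_gt0 R; nra.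
have sn0 k : (0 < sin (th k))%R by rewrite sin_gt0_pi // th0 thpi.
have iter k : rot_diff sqr 1 0 0 1 <=
    (4 ^+ k)%:E * rot_diff sqr 1 0 (cos (th k)) (sin (th k)).
  elim: k => [|k IH].
    by rewrite /th expr0 divr1 cos_pihalf sin_pihalf mul1e.
  have thE : (th k = th k.+1 *+ 2)%R.
    by rewrite /th exprS -mulr_natr; field; rewrite gt_eqF.
  apply: (le_trans IH); rewrite [in (4 ^+ k.+1)%R]exprSr EFinM -muleA.
  apply: lee_wpmul2l; first by rewrite lee_fin exprn_ge0.
  have -> : cos (th k) = (cos (th k.+1) ^+ 2 - sin (th k.+1) ^+ 2)%R.
    by rewrite thE cos_mulr2n -[(_ *+ 2)%R]mulr_natr sin2cos2; ring.
  have -> : sin (th k) = (2 * cos (th k.+1) * sin (th k.+1))%R.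
    by rewrite thE sin_mulr2n -[(_ *+ 2)%R]mulr_natr; ring.
  exact: (rot_diff_double gZ K0 r0 (cos2Dsin2 (th k.+1)) (lt0r_neq0 (sn0 k.+1))).
(* After [n] halvings [4 ^ n th^2 <= 4] and, as [n <= 4 ^ n], [th^2 <= 4 / n]. So
   [4 ^ n (1 - cos th)^2 <= 4 / n] as well, and the constant is [6 * (4 + 2 * 4) = 72]. *)
apply: (le_trans (iter n)).
have b4 : (0 <= 4 ^+ n :> R)%R by rewrite exprn_ge0.
apply: (le_trans (lee_wpmul2l _ (rot_diff_small gZ n0 K0 r0 (cos2Dsin2 (th n)) (sn0 n)))).
  by rewrite lee_fin.
rewrite -EFinM lee_fin.
have hc := cos_ge (x := th n); rewrite th0 thpi in hc; move: (hc isT) => {}hc.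
have hs := sin_le (th0 n); have c1 := cos_le1 (th n).
have np : (0 < n%:R :> R)%R by rewrite ltr0n.
have th4 : (4 ^+ n * th n ^+ 2 <= 4)%R.
  have -> : (4 ^+ n * th n ^+ 2 = (pi / 2) ^+ 2 :> R)%R.
    rewrite /th (_ : 4 = 2 * 2 :> R)%R; last by ring.
    by rewrite exprMn; field; rewrite gt_eqF.
  have := @pihalf_lt2 R; have := @pihalf_ge1 R; move: (pi / 2)%R => p; nra.
have n4 : (n%:R <= 4 ^+ n :> R)%R by rewrite -natrX ler_nat ltnW // ltn_expl.
have thn : (th n ^+ 2 <= 4 * n%:R^-1)%R.
  by rewrite ler_pdivlMr //; have := sqr_ge0 (th n); nra.
have sq : (sin (th n) ^+ 2 <= th n ^+ 2)%R.
  by rewrite ler_sqr ?nnegrE // ltW.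
have cq : ((1 - cos (th n)) ^+ 2 <= th n ^+ 2 / 2 * (th n ^+ 2 / 2))%R.
  by rewrite expr2 ler_pM //; lra.
have r2 := sqr_ge0 r; have t0 := sqr_ge0 (th n).
have ni : (0 <= n%:R^-1 :> R)%R by rewrite invr_ge0.
move: (th n ^+ 2)%R (sin (th n) ^+ 2)%R ((1 - cos (th n)) ^+ 2)%R th4 thn sq cq b4 t0.
move=> t a b th4 thn sq cq b4 t0.
move: (4 ^+ n)%R (n%:R^-1)%R th4 thn ni b4 => q m th4 thn ni b4.
have qb : (q * b <= 4 * m)%R.
  have := ler_wpM2l b4 cq; have := ler_wpM2r t0 th4; lra.
have qa : (q * a * m <= 4 * m)%R.
  by rewrite ler_wpM2r // (le_trans _ th4) // ler_wpM2l.
have -> : (q * (6 * (b * r ^+ 2 + 2 * a * (m * r ^+ 2))) =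
  6 * (q * b + 2 * (q * a * m)) * r ^+ 2)%R by ring.
by rewrite [leRHS]mulrA ler_wpM2r //; lra.
Qed.

Lemma measurable_ksup_vector : measurable_fun [set: T] (fun w => H (xv w)).
Proof.
apply: (measurable_lipschitz gZ.1) => x y.
by apply: (ksup_lipschitz K0); exact: ltW.
Qed.

Lemma ksup_vector_sqr_le w : (H (xv w) ^+ 2 <= r ^+ 2 * ip (xv w) (xv w))%R.
Proof.
rewrite -ipnorm_sqr -exprMn ler_sqr ?nnegrE.
- exact: (ksup_le_nn K0 _ (ltW r0)).
- exact: (ksup_ge0 K0 _ (ltW r0)).
- by rewrite mulr_ge0 ?ipnorm_ge0 // ltW.
Qed.

Lemma integrable_ksup_vector :
  P.-integrable [set: T] (fun w => (H (xv w))%:E).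
Proof.
apply: (@integrable_gaussian_dominated _ _ _ _ _ _ gZ _ 1 (r ^+ 2)).
  exact: measurable_ksup_vector.
move=> w; rewrite ger0_norm ?(ksup_ge0 K0 _ (ltW r0)) //.
have := ksup_vector_sqr_le w; have := sqr_ge0 (H (xv w) - 1)%R.
have := sqr_ge0 (H (xv w)); lra.
Qed.

(* Jensen for an independent copy: [(a - W) ^ 2 <= E (a - H') ^ 2], by
   integrating [2 m (a - H') - m ^ 2 <= (a - H') ^ 2] with [m = a - W]. *)
Lemma ksup_variance :
  \int[P]_w ((H (xv w) - Rintegral P setT (fun w => H (xv w))) ^+ 2)%:E <=
  (72 * (n%:R^-1 * r ^+ 2))%:E.
Proof.
apply: le_trans rot_diff_quarter_turn.
rewrite /rotation_energy fubini_tonelli1; last 2 first.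
- exact: (measurable_rot_diff gZ K0 r0 _ _ _ _ (@measurable_sqr R)).
- by move=> w; rewrite lee_fin sqr_ge0.
set W := Rintegral _ _ _.
have mH := measurable_ksup_vector.
have WE : \int[P]_w (H (xv w))%:E = W%:E.
  by rewrite /W /Rintegral fineK //; exact: integrable_fin_num integrable_ksup_vector.
apply: ge0_le_integral => //.
- by move=> w _; rewrite lee_fin sqr_ge0.
- by apply/measurable_EFinP; apply: measurable_funX; apply: measurable_funB.
- apply: measurable_fun_fubini_tonelli_F => //.
  + exact: (measurable_rot_diff gZ K0 r0 _ _ _ _ (@measurable_sqr R)).
  + by move=> w; rewrite lee_fin sqr_ge0.
move=> w _; rewrite /fubini_F.
set a := H (xv w); pose m := (a - W)%R.
have e1 : \int[P]_w2 ((2 * m * a - m ^+ 2)%:E + (- (2 * m))%:E * (H (xv w2))%:E) =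
    (m ^+ 2)%:E.
  rewrite integralD //; last 2 first.
  - exact: (@finite_measure_integrable_cst _ _ _ P _ _ measurableT).
  - by apply: integrableZl => //; exact: integrable_ksup_vector.
  rewrite integral_prob_cst integralZl //; last first.
    exact: integrable_ksup_vector.
  by rewrite WE -EFinM -EFinD; congr EFin; rewrite /m; ring.
rewrite -/m -e1; apply: le_integral => //.
- apply: integrableD => //.
  + exact: (@finite_measure_integrable_cst _ _ _ P _ _ measurableT).
  + by apply: integrableZl => //; exact: integrable_ksup_vector.
- apply: (@integrable_gaussian_dominated _ _ _ _ _ _ gZ _ (2 * a ^+ 2) (2 * r ^+ 2)).
    apply/measurable_EFinP.
    have h := measurable_rot_diff gZ K0 r0 1 0 0 1 (@measurable_sqr R).
    exact: measurableT_comp h (pair1_measurable w).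
  move=> w2; rewrite ger0_norm ?sqr_ge0 // !lin2_copies /=.
  rewrite !scale1r !scale0r addr0 add0r /sqr -/a.
  by have := ksup_vector_sqr_le w2; have := sqr_ge0 (a + H (xv w2))%R; lra.
move=> w2 _; rewrite !lin2_copies /= scale1r !scale0r addr0 add0r ?scale1r.
rewrite -EFinM -EFinD lee_fin /sqr -/a.
by have := sqr_ge0 ((a - H (xv w2)) - m)%R; lra.
Qed.

End Variance.

(** * Risk of the projection *)

(** The restriction [e <= 1] lets [e] serve as a weight in concavity inequalities. *)
Lemma ler_addeps (R : realType) (a b c : R) : 0 <= c ->
  (forall e, 0 < e <= 1 -> a <= b + e * c) -> a <= b.
Proof.
move=> c0 h; apply/ler_addgt0Pr => e e0.
have c1 : 0 < c + 1 by lra.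
have m0 : 0 < Num.min 1 (e / (c + 1)) by rewrite lt_min ltr01 divr_gt0.
have := h (Num.min 1 (e / (c + 1))); rewrite m0 ge_min lexx => /(_ isT) /le_trans; apply.
rewrite lerD2l; apply: (@le_trans _ _ (e / (c + 1) * c)).
  by rewrite ler_wpM2r // ge_min lexx orbT.
by rewrite mulrAC ler_pdivrMr // ler_wpM2l ?ltW //; lra.
Qed.

Section ConcaveArgmax.
Context {R : realType}.
Variables (W : R -> R) (r0 : R).
Hypothesis W0 : W 0 = 0.
Hypothesis Wge0 : forall r, 0 <= r -> 0 <= W r.
Hypothesis Wconc : forall r s a, 0 <= r -> 0 <= s -> 0 <= a <= 1 ->
  a * W r + (1 - a) * W s <= W (a * r + (1 - a) * s).
Hypothesis r0_ge0 : 0 <= r0.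
Hypothesis r0max : forall r, 0 <= r -> W r - r ^+ 2 / 2 <= W r0 - r0 ^+ 2 / 2.

(* First-order optimality, with a radius [1] standing in for [r0] when the
   maximum is at [0], where [W] vanishes identically. *)
Lemma argmax_chord : exists rho, [/\ 0 < rho, W rho = W r0 &
  W (3 / 2 * rho) - W rho <= rho / 2 * rho].
Proof.
move: r0_ge0; rewrite le_eqVlt => /predU1P[r00|r0_gt0].
  have Wz r : 0 <= r -> W r = 0.
    move=> rp; apply/eqP; rewrite eq_le Wge0 // andbT.
    apply: (@ler_addeps _ _ _ (r ^+ 2 / 2)) => [|e /andP[e0 e1]].
      by have := sqr_ge0 r; lra.
    have e01 : 0 <= e <= 1 by rewrite e1 ltW.
    have := Wconc rp (lexx 0) e01; rewrite W0 !mulr0 !addr0.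
    have := r0max (mulr_ge0 (ltW e0) rp); rewrite -r00 W0 add0r => h1 h2.
    rewrite -(ler_pM2l e0); apply: (le_trans h2); move: h1.
    by rewrite expr0n /= mul0r oppr0; rewrite exprMn; lra.
  by exists 1; rewrite ltr01 -r00 !Wz //; split => //; lra.
(* The competitor of weight [e] towards [3/2 r0] has radius [(1 + e / 2) r0]. Its penalty exceeds
   that of [r0] by [e r0^2 / 2 + e^2 r0^2 / 8]; dividing by [e] gives the error term. *)
exists r0; split => //; apply: (@ler_addeps _ _ _ (r0 ^+ 2 / 8)) => [|e /andP[e0 e1]].
  by have := sqr_ge0 r0; lra.
have e01 : 0 <= e <= 1 by rewrite e1 ltW.
have r3 : 0 <= 3 / 2 * r0 by lra.
have := Wconc r3 (ltW r0_gt0) e01.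
have s0 : 0 <= e * (3 / 2 * r0) + (1 - e) * r0 by nra.
have := r0max s0; move: (W _) (W (3 / 2 * r0)) (W r0) => A B D h1 h2.
by rewrite -(ler_pM2l e0); lra.
Qed.

End ConcaveArgmax.

Section RealIntegral.
Context {R : realType} {d : measure_display} {T : measurableType d}.
Variable P : probability T R.

Lemma ge0_Rintegral_le (f : T -> R) (b : R) : measurable_fun [set: T] f ->
  (forall w, 0 <= f w) -> (\int[P]_w (f w)%:E <= b%:E)%E ->
  P.-integrable [set: T] (EFin \o f) /\ \int[P]_w f w <= b.
Proof.
move=> mf f0 fb.
have fi : P.-integrable [set: T] (EFin \o f).
  apply/integrableP; split; first exact/measurable_EFinP.
  under eq_integral do rewrite /= ger0_norm //.
  by rewrite (le_lt_trans fb) ?ltry.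
split => //; rewrite -lee_fin /Rintegral fineK //.
exact: integrable_fin_num fi.
Qed.

Lemma integrable_mulr (k : R) (f : T -> R) : P.-integrable [set: T] (EFin \o f) ->
  P.-integrable [set: T] (EFin \o (fun w => k * f w)).
Proof. by move=> /(integrableZl measurableT k); exact: eq_integrable. Qed.

Lemma integrable_addr (f g : T -> R) : P.-integrable [set: T] (EFin \o f) ->
  P.-integrable [set: T] (EFin \o g) ->
  P.-integrable [set: T] (EFin \o (fun w => f w + g w)).
Proof. by move=> fi gi; have := integrableD measurableT fi gi; exact: eq_integrable. Qed.

Lemma integrable_subr (f g : T -> R) : P.-integrable [set: T] (EFin \o f) ->
  P.-integrable [set: T] (EFin \o g) ->
  P.-integrable [set: T] (EFin \o (fun w => f w - g w)).
Proof. by move=> fi gi; have := integrableB measurableT fi gi; exact: eq_integrable. Qed.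

Lemma integrable_cstr (k : R) : P.-integrable [set: T] (EFin \o (fun=> k)).
Proof. exact: finite_measure_integrable_cst. Qed.

Lemma Rintegral_prob_cst (k : R) : \int[P]_w k = k.
Proof. by rewrite /Rintegral integral_prob_cst. Qed.

End RealIntegral.

(** * The mean support function as a function of the radius *)

Section ProjectionRisk.
Context {R : realType} {d : measure_display} {T : measurableType d}.
Variables (P : probability T R) (n : nat) (Z : 'I_n -> T -> R).
Hypothesis gZ : gaussian_family P Z.
Hypothesis n0 : (0 < n)%N.
Variable K : set 'rV[R]_n.
Hypothesis K0 : K 0.
Hypothesis Kconv : forall u v a, K u -> K v -> 0 <= a <= 1 ->
  K (a *: u + (1 - a) *: v).
Local Notation xv w := (\row_i Z i w).
Local Notation dom := (@integrable_gaussian_dominated _ _ _ _ _ _ gZ).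

Lemma integrable_ksup r : 0 <= r ->
  P.-integrable [set: T] (fun w => (ksup K r (xv w))%:E).
Proof.
rewrite le_eqVlt => /predU1P[<-|r0]; last exact: integrable_ksup_vector.
apply: (eq_integrable _ (fun=> 0%:E)) => // [w _|]; last exact: integrable0.
have := ksup_le_nn K0 (xv w) (lexx 0); have := ksup_ge0 K0 (xv w) (lexx 0).
by rewrite mul0r => h1 h2; congr EFin; apply/eqP; rewrite eq_le h1 h2.
Qed.

Definition mean_ksup r : R := \int[P]_w ksup K r (xv w).
Local Notation W := mean_ksup.

Lemma mean_ksup_ge0 r : 0 <= r -> 0 <= W r.
Proof. by move=> r0; apply: Rintegral_ge0 => w _; exact: ksup_ge0. Qed.

Lemma Rintegral_ip_self : \int[P]_w ip (xv w) (xv w) <= 1.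
Proof.
have [] // := ge0_Rintegral_le (measurable_gaussian_ip_self gZ)
  (fun w => ip_ge0 (xv w)) (gaussian_ip_self gZ).
Qed.

Lemma mean_ksup_le r : 0 <= r -> W r <= r.
Proof.
move=> r0; have i1 := integrable_gaussian_ip_self gZ.
have i2 := integrable_cstr P 1.
apply: (@le_trans _ _ (\int[P]_w (r / 2 * (1 + ip (xv w) (xv w))))).
  apply: le_Rintegral => //; first exact: integrable_ksup.
    by apply: integrable_mulr; exact: integrable_addr.
  move=> w _; apply: le_trans (ksup_le_nn K0 _ r0) _; rewrite -ipnorm_sqr.
  have := mulr_ge0 r0 (sqr_ge0 (ipnorm (xv w) - 1)); lra.
rewrite RintegralZl //; last exact: integrable_addr.
rewrite RintegralD // Rintegral_prob_cst.
by have := ler_wpM2l r0 Rintegral_ip_self; lra.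
Qed.

Lemma mean_ksup0 : W 0 = 0.
Proof. by apply/eqP; rewrite eq_le mean_ksup_le // mean_ksup_ge0. Qed.

Lemma mean_ksup_concave r s a : 0 <= r -> 0 <= s -> 0 <= a <= 1 ->
  a * W r + (1 - a) * W s <= W (a * r + (1 - a) * s).
Proof.
move=> r0 s0 a01; have /andP[a0 a1] := a01.
have b0 : 0 <= 1 - a by lra.
have ir := integrable_ksup r0; have is_ := integrable_ksup s0.
rewrite /W -!RintegralZl // -RintegralD //; last 2 first.
- exact: integrable_mulr.
- exact: integrable_mulr.
apply: le_Rintegral => //.
- by apply: integrable_addr; exact: integrable_mulr.
- by apply: integrable_ksup; rewrite addr_ge0 // mulr_ge0.
- by move=> w _; exact: ksup_concave.
Qed.

(** For [s <= r], concavity from 0 gives [W s >= (s / r) W r], so the increment is at most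
    [(1 - s / r) W r <= r - s]. It provides the continuity behind the existence of the maximizing
    radius. *)
Lemma mean_ksup_lipschitz r s : 0 <= r -> 0 <= s -> `|W r - W s| <= `|r - s|.
Proof.
wlog rs : r s / s <= r.
  move=> h r0 s0; have /orP[] := le_total s r; first by move=> /h; apply.
  by move=> /h; rewrite distrC (distrC r); apply.
move=> r0 s0; rewrite [leRHS]ger0_norm ?subr_ge0 //.
have mono : W s <= W r.
  by apply: le_Rintegral => // [||w _]; [exact: integrable_ksup..|exact: ksup_mono].
rewrite ger0_norm ?subr_ge0 //.
have [re|rp] := eqVneq r 0; first by have := mean_ksup_le r0; have := mean_ksup_ge0 s0; lra.
have {}rp : 0 < r by rewrite lt_neqAle eq_sym rp.
have sr : 0 <= s / r <= 1 by rewrite divr_ge0 //= ler_pdivrMr // mul1r.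
have := mean_ksup_concave r0 (lexx 0) sr.
rewrite mean_ksup0 !mulr0 !addr0 divfK ?gt_eqF // => h.
have := mean_ksup_le r0; have /andP[_ sr1] := sr => hW.
have : (1 - s / r) * W r <= (1 - s / r) * r by rewrite ler_wpM2l // subr_ge0.
rewrite !mulrBl divfK ?gt_eqF // !mul1r; lra.
Qed.

End ProjectionRisk.

Section ArgmaxExistence.
Import numFieldNormedType.Exports.
Context {R : realType}.
Variable W : R -> R.
Hypothesis W0 : W 0 = 0.
Hypothesis Wle : forall r, 0 <= r -> W r <= r.
Hypothesis Wlip : forall r s, 0 <= r -> 0 <= s -> `|W r - W s| <= `|r - s|.

(** Past [r = 2] the bound [W r <= r] makes the objective at most 0, its value at 0, so the compact
    interval from 0 to 2 suffices. Composing with the absolute value extends [W] continuously to the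
    whole line. *)
Lemma penalized_argmax_exists :
  exists2 r0, 0 <= r0 & forall r, 0 <= r -> W r - r ^+ 2 / 2 <= W r0 - r0 ^+ 2 / 2.
Proof.
have cW : continuous (fun r : R => W `|r|).
  move=> x; apply/cvgrPdist_lt => e e0; near=> y.
  apply: (le_lt_trans (Wlip (normr_ge0 _) (normr_ge0 _))).
  apply: (le_lt_trans (ler_dist_dist _ _)).
  by near: y; apply: cvgr_dist_lt.
have c2 : continuous (fun r : R => W `|r| - r ^+ 2 / 2).
  move=> x; apply: cvgB; first exact: cW.
  by apply: cvgM; [exact: exprn_continuous|exact: cvg_cst].
have [|c] := @EVT_max R (fun r => W `|r| - r ^+ 2 / 2) 0 2 _ (continuous_subspaceT c2).
  lra.
rewrite in_itv /= => /andP[cge0 _] hmax; exists c => // r r0.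
rewrite (ger0_norm cge0) in hmax.
have [r2|r2] := lerP r 2.
  by have := hmax r; rewrite in_itv /= r0 r2 => /(_ isT); rewrite ger0_norm.
have := hmax 0; rewrite in_itv /= lexx normr0 W0 => h.
have h' : 0 - 0 ^+ 2 / 2 <= W c - c ^+ 2 / 2 by apply: h; lra.
by apply: le_trans h'; have := Wle r0; nra.
Unshelve. all: by end_near.
Qed.

End ArgmaxExistence.

(** * Measurability and moments of the projected noise *)

Section ProjectionRisk.
Context {R : realType} {d : measure_display} {T : measurableType d}.
Variables (P : probability T R) (n : nat) (Z : 'I_n -> T -> R).
Hypothesis gZ : gaussian_family P Z.
Hypothesis n0 : (0 < n)%N.
Variable K : set 'rV[R]_n.
Hypothesis K0 : K 0.
Hypothesis Kconv : forall u v a, K u -> K v -> 0 <= a <= 1 ->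
  K (a *: u + (1 - a) *: v).
Local Notation xv w := (\row_i Z i w).
Local Notation W := (mean_ksup P Z K).
Variable p : T -> 'rV[R]_n.
Hypothesis near_p : forall w, nearest K (p w) (xv w).

(** The projection is nonexpansive, hence continuous in the noise. Undoing the normalization of
    [ipnorm] costs at most a factor [n] per coordinate, and [n.+1] makes the final inequality
    strict. *)
Lemma measurable_nearest_coord i : measurable_fun [set: T] (fun w => p w 0 i).
Proof.
apply: (measurable_fun_of_continuity gZ.1) => w e e0.
have n1 : 0 < n.+1%:R :> R by rewrite ltr0n.
exists (e / n.+1%:R) => [|w' h]; first exact: divr_gt0.
have le1 : ipnorm (p w - p w') <= e / n.+1%:R.
  apply: le_trans (nearest_nonexpansive Kconv (near_p w) (near_p w')) _.
  apply: ipnorm_le_coord => [|j]; first by rewrite ltW // divr_gt0.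
  by rewrite !mxE ltW.
have np : 1 <= n%:R :> R by rewrite ler1n.
have sq : (p w 0 i - p w' 0 i) ^+ 2 <= n%:R * ipnorm (p w - p w') ^+ 2.
  rewrite ipnorm_sqr /ip mulrA divff ?gt_eqF ?ltr0n // mul1r (bigD1 i) //= !mxE -expr2.
  by rewrite lerDl sumr_ge0 // => j _; rewrite -expr2 sqr_ge0.
have : `|p w 0 i - p w' 0 i| <= n%:R * ipnorm (p w - p w').
  rewrite -ler_sqr ?nnegrE ?mulr_ge0 ?ipnorm_ge0 // real_normK ?num_real //.
  apply: (le_trans sq); rewrite exprMn ler_wpM2r ?sqr_ge0 //.
  by rewrite expr2 ler_peMl.
move=> /le_lt_trans; apply.
have : n%:R * ipnorm (p w - p w') <= n%:R * (e / n.+1%:R) by rewrite ler_wpM2l.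
move=> /le_lt_trans; apply.
by rewrite mulrA ltr_pdivrMr // mulrC ltr_pM2l // ltr_nat.
Qed.

Lemma measurable_nearest_nn : measurable_fun [set: T] (fun w => ipnorm (p w)).
Proof.
have := measurable_lipschitz measurable_nearest_coord ipnorm_lipschitz.
by apply: eq_measurable_fun => w _; congr ipnorm; apply/rowP => i; rewrite mxE.
Qed.

Lemma measurable_nearest_ip : measurable_fun [set: T] (fun w => ip (xv w) (p w)).
Proof.
apply: measurable_funM => //; apply: measurable_sum => i.
under eq_fun do rewrite mxE.
by apply: measurable_funM; [exact: gZ.1|exact: measurable_nearest_coord].
Qed.

Local Notation dom := (integrable_gaussian_dominated gZ).

Lemma nearest_sqr_le w : ipnorm (p w) ^+ 2 <= ip (xv w) (xv w).
Proof. by rewrite -ipnorm_sqr ler_sqr ?nnegrE ?ipnorm_ge0 // (nearest_le K0 Kconv). Qed.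

Lemma integrable_nearest_sqr : P.-integrable [set: T] (EFin \o (fun w => ipnorm (p w) ^+ 2)).
Proof.
apply: (dom (a := 0) (b := 1)) => [|w].
  by apply: measurable_funX; exact: measurable_nearest_nn.
by rewrite add0r mul1r ger0_norm ?sqr_ge0 // nearest_sqr_le.
Qed.

Lemma integrable_nearest_nn : P.-integrable [set: T] (EFin \o (fun w => ipnorm (p w))).
Proof.
apply: (dom (a := 1) (b := 1)) => [|w]; first exact: measurable_nearest_nn.
rewrite mul1r ger0_norm ?ipnorm_ge0 //.
have := nearest_sqr_le w; have := sqr_ge0 (ipnorm (p w) - 1).
by have := sqr_ge0 (ipnorm (p w)); lra.
Qed.

(** Young's inequality; the weight [a] is free so that it can be tuned to the risk after taking
    expectations. *)
Lemma nearest_ip_le w a : 0 < a ->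
  `|ip (xv w) (p w)| <= (a * ip (xv w) (xv w) + a^-1 * ipnorm (p w) ^+ 2) / 2.
Proof.
move=> a0; apply: le_trans (ip_norm_le _ _) _; rewrite -ipnorm_sqr.
move: (ipnorm _) (ipnorm _) => x y; rewrite ler_pdivlMr // -(ler_pM2l a0).
rewrite [leRHS]mulrDr (mulrA a a^-1) divff ?gt_eqF // mul1r.
by have := sqr_ge0 (a * y - x); lra.
Qed.

Lemma integrable_nearest_ip : P.-integrable [set: T] (EFin \o (fun w => ip (xv w) (p w))).
Proof.
apply: (dom (a := 0) (b := 1)) => [|w]; first exact: measurable_nearest_ip.
have := nearest_ip_le w ltr01; have := nearest_sqr_le w; rewrite invr1; lra.
Qed.

Definition risk : R := \int[P]_w ipnorm (p w) ^+ 2.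

Lemma risk_ge0 : 0 <= risk.
Proof. by apply: Rintegral_ge0 => w _; exact: sqr_ge0. Qed.

(** Jensen's inequality, by integrating the tangent [2 m y - m^2 <= y^2] at the mean [m]. *)
Lemma mean_nearest_le : \int[P]_w ipnorm (p w) <= Num.sqrt risk.
Proof.
set m := \int[P]_w _.
have m0 : 0 <= m by apply: Rintegral_ge0 => w _; exact: ipnorm_ge0.
rewrite -ler_sqr ?nnegrE ?sqrtr_ge0 // sqr_sqrtr ?risk_ge0 //.
have i1 := integrable_nearest_nn; have i2 := integrable_nearest_sqr.
have : \int[P]_w (2 * m * ipnorm (p w) - m ^+ 2) <= risk.
  apply: le_Rintegral => //.
    by apply: integrable_subr; [exact: integrable_mulr|exact: integrable_cstr].
  by move=> w _; have := sqr_ge0 (ipnorm (p w) - m); lra.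
rewrite RintegralB //; [|exact: integrable_mulr|exact: integrable_cstr].
by rewrite RintegralZl // Rintegral_prob_cst -/m; lra.
Qed.

(** Cauchy-Schwarz in expectation with [E |xi|^2 <= 1]: the weight in Young's inequality is [s + e],
    where [e] covers the case of zero risk. *)
Lemma mean_nearest_ip_le : \int[P]_w ip (xv w) (p w) <= Num.sqrt risk.
Proof.
set s := Num.sqrt risk; have s0 : 0 <= s by exact: sqrtr_ge0.
have s2 : s ^+ 2 = risk by rewrite sqr_sqrtr // risk_ge0.
apply/ler_addgt0Pr => e e0; have se : 0 < s + e by lra.
have i1 := integrable_gaussian_ip_self gZ; have i2 := integrable_nearest_sqr.
have i3 : P.-integrable [set: T] (EFin \o (fun w =>
    (s + e) / 2 * ip (xv w) (xv w) + (s + e)^-1 / 2 * ipnorm (p w) ^+ 2)).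
  by apply: integrable_addr; exact: integrable_mulr.
apply: (@le_trans _ _ (\int[P]_w ((s + e) / 2 * ip (xv w) (xv w) +
    (s + e)^-1 / 2 * ipnorm (p w) ^+ 2))).
  apply: le_Rintegral => //; first exact: integrable_nearest_ip.
  by move=> w _; have := nearest_ip_le w se; rewrite ler_norml => /andP[_]; lra.
rewrite RintegralD //; [|exact: integrable_mulr|exact: integrable_mulr].
rewrite [X in X + _]RintegralZl // [X in _ + X]RintegralZl //.
have -> : \int[P]_w ipnorm (p w) ^+ 2 = s ^+ 2 by rewrite s2.
have h1 : (s + e) / 2 * \int[P]_w ip (xv w) (xv w) <= (s + e) / 2 * 1.
  by rewrite ler_wpM2l ?(Rintegral_ip_self gZ) //; lra.
have : (s + e)^-1 * s ^+ 2 <= s + e.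
  by rewrite mulrC ler_pdivrMr //; nra.
by move: ((s + e)^-1) (\int[P]_w _) h1 => q J h1; lra.
Qed.

End ProjectionRisk.

(** * Gaussian averages bounded through the risk *)

Section ProjectionRisk.
Context {R : realType} {d : measure_display} {T : measurableType d}.
Variables (P : probability T R) (n : nat) (Z : 'I_n -> T -> R).
Hypothesis gZ : gaussian_family P Z.
Hypothesis n0 : (0 < n)%N.
Variable K : set 'rV[R]_n.
Hypothesis K0 : K 0.
Hypothesis Kconv : forall u v a, K u -> K v -> 0 <= a <= 1 ->
  K (a *: u + (1 - a) *: v).
Local Notation xv w := (\row_i Z i w).
Local Notation W := (mean_ksup P Z K).
Variable p : T -> 'rV[R]_n.
Hypothesis near_p : forall w, nearest K (p w) (xv w).

Local Notation risk := (risk P p).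
Local Notation excess := (\int[P]_w (ip (xv w) (p w) - ipnorm (p w) ^+ 2)).

Let iN := integrable_nearest_nn gZ n0 K0 Kconv near_p.
Let iS := integrable_nearest_sqr gZ n0 K0 Kconv near_p.
Let iI := integrable_nearest_ip gZ n0 K0 Kconv near_p.

(** Meant for [K'] equal to the class recentred at [g]. Recentring introduces [- <xi, g>], which has
    mean zero, so integrating [nearest_ub] leaves exactly these terms. *)
Lemma mean_ksup_shift_le (K' : set 'rV[R]_n) (g : 'rV[R]_n) (t : R) : 0 <= t ->
  K' 0 -> (forall u, K' u -> K (u + g)) ->
  mean_ksup P Z K' t <= excess + (ipnorm g + t) * \int[P]_w ipnorm (p w).
Proof.
move=> t0 K'0 K'K.
have iG := integrable_gaussian_ip gZ g.
have iE := integrable_subr iI iS.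
apply: (@le_trans _ _ (\int[P]_w ((ip (xv w) (p w) - ipnorm (p w) ^+ 2) +
    (ipnorm g + t) * ipnorm (p w) - ip (xv w) g))).
  apply: le_Rintegral => //.
  - exact: integrable_ksup.
  - apply: integrable_subr => //; apply: integrable_addr => //.
    exact: integrable_mulr.
  move=> w _; apply: ksup_le => // u K'u ut.
  have ug : ipnorm (u + g - g) <= t by rewrite addrK.
  by have := nearest_ub Kconv (near_p w) (K'K u K'u) ug; rewrite ipDr; lra.
rewrite RintegralB //; last first.
  by apply: integrable_addr => //; exact: integrable_mulr.
rewrite RintegralD //; last exact: integrable_mulr.
rewrite [X in _ + X - _]RintegralZl //.
by rewrite [X in _ - X]/Rintegral gaussian_ip_centered // subr0.
Qed.

Lemma excess_le_ip : excess <= \int[P]_w ip (xv w) (p w).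
Proof.
apply: le_Rintegral => //; first exact: integrable_subr.
by move=> w _; rewrite lerBlDr lerDl sqr_ge0.
Qed.

(** Case [g = 0], [t = 1]: the means of [<xi, v>] and of [|v|] each cost one square root of the
    risk. The factor 2 becomes the 4 of the first bound. *)
Lemma mean_ksup1_le : W 1 <= 2 * Num.sqrt risk.
Proof.
have KK u : K u -> K (u + 0) by rewrite addr0.
have := mean_ksup_shift_le ler01 K0 KK; rewrite ipnorm0 add0r mul1r.
have := excess_le_ip; have := mean_nearest_le gZ n0 K0 Kconv near_p.
have := mean_nearest_ip_le gZ n0 K0 Kconv near_p.
lra.
Qed.

Lemma Rintegral_ksup_variance r : 0 < r ->
  P.-integrable [set: T] (EFin \o (fun w => (ksup K r (xv w) - W r) ^+ 2)) /\
  \int[P]_w (ksup K r (xv w) - W r) ^+ 2 <= 72 * (n%:R^-1 * r ^+ 2).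
Proof.
move=> r0; apply: ge0_Rintegral_le => [|w|].
- apply: measurable_funX; apply: measurable_funB => //.
  exact: (measurable_ksup_vector gZ K0 r0).
- exact: sqr_ge0.
- exact: ksup_variance.
Qed.

(** The variances at [3/2 rho] and [rho] are at most [72 r^2 / n], and [rho] cancels against
    [k = 2 / rho^2]: the constant is [2 * 72 * (9 / 4 + 1) = 468]. *)
Lemma excess_le rho : 0 < rho -> W (3 / 2 * rho) - W rho <= rho / 2 * rho ->
  excess <= W rho + 468 / n%:R.
Proof.
move=> rho0 hW; have r3 : 0 < 3 / 2 * rho by lra.
have aux1 (u v a b c e : R) : a - b <= c -> (u - a) - (v - b) <= e -> u - v <= c + e.
  by lra.
have aux3 (q : R) : 2 * (234 * q) = 468 * q by ring.
have aux2 (a b : R) : (a - b) ^+ 2 / 2 <= a ^+ 2 + b ^+ 2.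
  by have := sqr_ge0 (a + b); lra.
have [i1 b1] := Rintegral_ksup_variance r3.
have [i2 b2] := Rintegral_ksup_variance rho0.
pose D1 w := ksup K (3 / 2 * rho) (xv w) - W (3 / 2 * rho).
pose D2 w := ksup K rho (xv w) - W rho.
have iH := integrable_ksup gZ K0 (ltW rho0).
pose k := 2 / rho ^+ 2.
have k0 : 0 < k by rewrite divr_gt0 // exprn_gt0.
have kr : k * rho ^+ 2 = 2 by rewrite divfK // gt_eqF // exprn_gt0.
have iD : P.-integrable [set: T] (EFin \o (fun w => D1 w ^+ 2 + D2 w ^+ 2)).
  exact: integrable_addr.
apply: (@le_trans _ _ (\int[P]_w (ksup K rho (xv w) + k * (D1 w ^+ 2 + D2 w ^+ 2)))).
  apply: le_Rintegral => //.
  - exact: integrable_subr.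
  - by apply: integrable_addr => //; exact: integrable_mulr.
  (* [z] is the fluctuation of the increment divided by the length [rho / 2]; with it the chord
     bound on [W] carries over to the realized support function. *)
  move=> w _; pose z := 2 / rho * `|D1 w - D2 w|.
  have z0 : 0 <= z by rewrite mulr_ge0 // divr_ge0 // ltW.
  have hz : ksup K (3 / 2 * rho) (xv w) - ksup K rho (xv w) <= rho / 2 * (rho + z).
    have -> : rho / 2 * (rho + z) = rho / 2 * rho + `|D1 w - D2 w|.
      by rewrite /z; field; rewrite gt_eqF.
    exact: aux1 hW (ler_norm (D1 w - D2 w)).
  have h := ksup_sub_sqr K0 Kconv rho0 z0 (ipnorm_ge0 (p w)) hz.
  have h2 : ip (xv w) (p w) <= ksup K (ipnorm (p w)) (xv w).
    by apply: ksup_ub => //; exact: (near_p w).1.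
  have z2 : z ^+ 2 / 4 <= k * (D1 w ^+ 2 + D2 w ^+ 2).
    have -> : z ^+ 2 / 4 = k * ((D1 w - D2 w) ^+ 2 / 2).
      rewrite /z /k exprMn real_normK ?num_real //; field; rewrite gt_eqF //.
    by rewrite ler_wpM2l ?(ltW k0).
  apply: (le_trans (lerB h2 (lexx _))); apply: (le_trans h).
  by rewrite lerD2l.
rewrite RintegralD //; last exact: integrable_mulr.
rewrite lerD2l [X in X <= _]RintegralZl // RintegralD //.
have : k * (\int[P]_w D1 w ^+ 2 + \int[P]_w D2 w ^+ 2) <=
    k * (72 * (n%:R^-1 * (3 / 2 * rho) ^+ 2) + 72 * (n%:R^-1 * rho ^+ 2)).
  by rewrite ler_wpM2l ?(ltW k0) // lerD.
move=> /le_trans; apply.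
have -> : k * (72 * (n%:R^-1 * (3 / 2 * rho) ^+ 2) + 72 * (n%:R^-1 * rho ^+ 2)) =
  k * rho ^+ 2 * (234 * n%:R^-1) by field; rewrite gt_eqF // ltr0n.
by rewrite kr aux3.
Qed.

End ProjectionRisk.

(** * Fixed-design regression *)

Section EmpiricalVectors.
Context {R : realType} {X : Type} {n : nat}.
Variables (F : set (X -> R)) (x : 'I_n -> X).
Implicit Types f g : X -> R.

Definition design_row f : 'rV[R]_n := \row_i f (x i).

Definition centered g : set 'rV[R]_n := [set design_row (f \- g) | f in F].

Lemma emp_int_sqr f : emp_int x (fun z => f z ^+ 2) = ipnorm (design_row f) ^+ 2.
Proof.
rewrite ipnorm_sqr; congr (_ * _).
by apply: eq_bigr => i _; rewrite mxE expr2.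
Qed.

Lemma emp_norm_row f : emp_norm x f = ipnorm (design_row f).
Proof. by rewrite /emp_norm emp_int_sqr sqrtr_sqr ger0_norm ?ipnorm_ge0. Qed.

Lemma design_rowB f g : design_row (f \- g) = design_row f - design_row g.
Proof. by apply/rowP => i; rewrite !mxE. Qed.

Lemma centered0 g : F g -> centered g 0.
Proof. by move=> Fg; exists g => //; rewrite design_rowB subrr. Qed.

Lemma centered_convex g : convex_set (F : set (convex_lmodType (X -> R^o))) ->
  forall u v a, centered g u -> centered g v -> 0 <= a <= 1 ->
  centered g (a *: u + (1 - a) *: v).
Proof.
move=> cF _ _ a [f1 F1 <-] [f2 F2 <-] /andP[a0 a1].
have := cF f1 f2 (Itv01 a0 a1) (mem_set F1) (mem_set F2); rewrite inE => F12.
exists (fun z => a * f1 z + (1 - a) * f2 z); first exact: F12.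
by apply/rowP => i; rewrite !mxE /=; ring.
Qed.

Context {d : measure_display} {T : measurableType d} {P : probability T R}.
Variable xi : 'I_n -> {RV P >-> R}.
Local Notation xv w := (\row_i xi i w).

Lemma iid_gaussian_family :
  iid_standard_normal xi -> gaussian_family P (fun i => xi i : T -> R).
Proof.
move=> [indep law]; split => [i|B mB]; first exact: measurable_funPT.
have e : [set` [set: 'I_n]%SET] = [set: 'I_n].
  by apply/seteqP; split => i //= _; rewrite inE.
have := indep [set: 'I_n]%SET B mB; rewrite e.
rewrite (eq_bigl predT) => [|i]; last by rewrite inE.
rewrite (eq_bigr (fun i => fine (normal_prob 0 1 (B i)))) => [|i _].
  move=> <-; rewrite fineK //; apply: fin_num_measure.
  apply: fin_bigcap_measurable => [|i _]; first exact: finite_finset.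
  by rewrite -[X in measurable X]setTI; apply: measurable_funPT.
by rewrite -(law i (B i) (mB i)).
Qed.

(** Recentring the ball at [g] changes the supremum by [<xi, g>], whose mean is zero. *)
Lemma gauss_avgE g t : gaussian_family P (fun i => xi i : T -> R) -> F g -> 0 <= t ->
  gauss_avg x xi (emp_ball F x g t) =
  mean_ksup P (fun i => xi i : T -> R) (centered g) t.
Proof.
move=> gZ Fg t0; have K0 := centered0 Fg.
have ipE w f : n%:R^-1 * \sum_(i < n) xi i w * f (x i) = ip (xv w) (design_row f).
  by congr (_ * _); apply: eq_bigr => i _; rewrite !mxE.
have supE w : sup [set n%:R^-1 * \sum_(i < n) xi i w * f (x i) | f in emp_ball F x g t] =
    ksup (centered g) t (xv w) + ip (xv w) (design_row g).
  have ub f : emp_ball F x g t f -> ip (xv w) (design_row f) <=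
      ksup (centered g) t (xv w) + ip (xv w) (design_row g).
    move=> [Ff fg]; rewrite -lerBlDr -ipNr -ipDr -design_rowB.
    by apply: ksup_ub => //; [exists f|rewrite -emp_norm_row].
  have gg : emp_ball F x g t g.
    by split => //; rewrite emp_norm_row design_rowB subrr ipnorm0.
  apply/eqP; rewrite eq_le; apply/andP; split.
    apply: ge_sup; first by eexists; exists g => //.
    by move=> _ [f ff <-]; rewrite ipE; exact: ub.
  rewrite -lerBrDr; apply: ksup_le => // _ [f Ff <-] fg.
  rewrite lerBrDr -ipDr design_rowB subrK -ipE.
  apply: ub_le_sup; last first.
    by exists f => //; split => //; rewrite emp_norm_row.
  exists (ksup (centered g) t (xv w) + ip (xv w) (design_row g)).
  by move=> _ [f' ff <-]; rewrite ipE; exact: ub.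
rewrite /gauss_avg unlock.
under eq_integral do rewrite supE.
have -> : fine (\int[P]_w (ksup (centered g) t (xv w) + ip (xv w) (design_row g))%:E)%E =
  \int[P]_w (ksup (centered g) t (xv w) + ip (xv w) (design_row g)) by [].
rewrite RintegralD //; last 2 first.
- exact: integrable_ksup.
- exact: (integrable_gaussian_ip gZ).
by rewrite [X in _ + X]/Rintegral (gaussian_ip_centered gZ) addr0.
Qed.

(** The residual [Y - f] is [xi - (f - f0)], so least squares over [F] projects the noise onto
    [F - f0]. *)
Lemma lse_nearest f0 f w : lse_minimizers F x (response x xi f0 w) f ->
  nearest (centered f0) (design_row (f \- f0)) (xv w).
Proof.
have e h : ip (xv w - design_row (h \- f0)) (xv w - design_row (h \- f0)) =
    n%:R^-1 * \sum_(i < n) (response x xi f0 w i - h (x i)) ^+ 2.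
  congr (_ * _); apply: eq_bigr => i _; rewrite !mxE /response -expr2 /=.
  by congr (_ ^+ 2); ring.
move=> [Ff fmin]; split => [|_ [h Fh <-]]; first by exists f.
by rewrite !e ler_wpM2l ?invr_ge0 ?ler0n // fmin.
Qed.

End EmpiricalVectors.

(* The difference in the first term is replaced by its positive part: without
   it the inequality fails for F = [set f0], where the left-hand side is 0
   and gauss_avg vanishes. *)
Theorem lemma3p1 (R : realType) :
  exists2 C : R, 1 < C &
  forall (X : Type) (F : set (X -> R)) (n : nat) (x : 'I_n -> X)
    (d : measure_display) (T : measurableType d) (P : probability T R)
    (xi : 'I_n -> {RV P >-> R})
    (Psi : set (X -> R) -> (X -> R)) (f0 : X -> R),
  (0 < n)%N ->
  convex_set (F : set (convex_lmodType (X -> R^o))) ->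
  F f0 ->
  iid_standard_normal xi ->
  (forall w : T, lse_minimizers F x (response x xi f0 w) (lse F x xi Psi f0 w)) ->
  ((Num.max
      (Num.max 0 (gauss_avg x xi (emp_ball F x f0 1) - C / n%:R) ^+ 2 / 4)
      (L_bound F x xi C f0 ^+ 2))%:E
   <= 'E_P[fun w => emp_int x (fun z => (lse F x xi Psi f0 w z - f0 z) ^+ 2)%R])%E.
Proof.
exists 468; first by rewrite ltr1n.
have aux (a b c e u v : R) : a <= e + u -> u <= v -> e <= b + c -> a - b - c <= v.
  by lra.
have aux2 (a b c : R) : 0 <= a -> - (b + c + 1) <= a - b - c by lra.
move=> X F n x d T P xi Psi f0 n0 cF Ff0 iid hlse.
have gZ := iid_gaussian_family iid.
pose Z (i : 'I_n) : T -> R := xi i.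
pose K := centered F x f0.
have K0 : K 0 := centered0 x Ff0.
have Kconv := @centered_convex _ _ _ _ x f0 cF.
pose p w := design_row x (lse F x xi Psi f0 w \- f0).
have near_p w : nearest K (p w) (\row_i Z i w) := lse_nearest (hlse w).
pose W := mean_ksup P Z K.
have avgE r : 0 <= r -> gauss_avg x xi (emp_ball F x f0 r) = W r.
  exact: gauss_avgE.
have iS := integrable_nearest_sqr gZ n0 K0 Kconv near_p.
have -> : ('E_P[fun w => emp_int x (fun z => (lse F x xi Psi f0 w z - f0 z) ^+ 2)%R] =
    (risk P p)%:E)%E.
  rewrite unlock /risk /Rintegral fineK; last exact: integrable_fin_num.
  by apply: eq_integral => w _; rewrite -emp_int_sqr.
have rk0 := risk_ge0 P p.
set s := Num.sqrt (risk P p).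
have s0 : 0 <= s by exact: sqrtr_ge0.
have s2 : s ^+ 2 = risk P p by rewrite sqr_sqrtr.
have C0 : 0 <= 468 / n%:R :> R by rewrite divr_ge0.
rewrite lee_fin -s2 ge_max; apply/andP; split.
  rewrite avgE //; set m := Num.max 0 _.
  have m0 : 0 <= m by rewrite le_max lexx.
  have ms : m <= 2 * s.
    rewrite ge_max mulr_ge0 //= (le_trans _ (mean_ksup1_le gZ n0 K0 Kconv near_p)) //.
    by rewrite lerBlDr lerDl.
  rewrite ler_pdivrMr //; apply: (@le_trans _ _ ((2 * s) ^+ 2)).
    by rewrite ler_sqr ?nnegrE ?mulr_ge0.
  by rewrite exprMn mulrC -natrX.
pose r0 := opt_radius F x xi f0.
have [r0_ge0 r0max] : 0 <= r0 /\
    forall r, 0 <= r -> W r - r ^+ 2 / 2 <= W r0 - r0 ^+ 2 / 2.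
  (* Since a maximizer exists, [xget] in [opt_radius] returns one and not its default 0. *)
  have [c c0 cmax] := penalized_argmax_exists (mean_ksup0 gZ K0)
    (mean_ksup_le gZ K0) (mean_ksup_lipschitz gZ K0 Kconv).
  have : argmax_set [set r : R | 0 <= r]
      (fun r => gauss_avg x xi (emp_ball F x f0 r) - r ^+ 2 / 2) r0.
    apply: xgetPex; exists c; split => // r r_ge0.
    by rewrite !avgE //; exact: cmax.
  by move=> [h1 h2]; split => // r r_ge0; have := h2 r r_ge0; rewrite !avgE.
have [rho [rho0 Wrho chord]] := argmax_chord (mean_ksup0 gZ K0)
  (mean_ksup_ge0 P Z K0) (mean_ksup_concave gZ K0 Kconv) r0_ge0 r0max.
have exc := excess_le gZ n0 K0 Kconv near_p rho0 chord.
rewrite Wrho in exc.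
have W0 : 0 <= W r0 := mean_ksup_ge0 P Z K0 r0_ge0.
rewrite /L_bound -/r0 (avgE r0) //.
set S := [set ell | _].
have Sub ell : S ell -> ell <= s.
  move=> [g [t [[Fg _] t0 dt ->]]]; rewrite ler_pdivrMr //.
  rewrite (gauss_avgE x gZ Fg t0) emp_norm_row.
  have KK u : centered F x g u -> K (u + design_row x (g \- f0)).
    move=> [f Ff <-]; exists f => //; rewrite !design_rowB.
    by rewrite addrA subrK.
  have := mean_ksup_shift_le gZ n0 K0 Kconv near_p t0 (centered0 x Fg) KK.
  have dt' : 0 <= ipnorm (design_row x (g \- f0)) + t by rewrite addr_ge0 ?ipnorm_ge0.
  have := ler_wpM2l dt' (mean_nearest_le gZ n0 K0 Kconv near_p).
  by move=> h1 h2; rewrite [leRHS]mulrC; exact: aux h2 h1 exc.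
have hub : has_ubound S by exists s => ell; exact: Sub.
have Sel t : 0 < t -> S ((W t - W r0 - 468 / n%:R) / t).
  move=> t0; exists f0, t.
  have z : emp_norm x (f0 \- f0) = 0 by rewrite emp_norm_row design_rowB subrr ipnorm0.
  split; [|exact: ltW|by rewrite z add0r|by rewrite z add0r avgE ?ltW].
  by split; rewrite ?z.
have L1 : sup S <= s.
  by apply: ge_sup => //; exists ((W 1 - W r0 - 468 / n%:R) / 1); exact: Sel.
(* Squaring [L1] requires a nonnegative supremum. With [g = f0] and [t] large the numerator stays
   above [- b], so at [t = b / e] the ratio is at least [- e]. *)
have L0 : 0 <= sup S.
  rewrite -oppr_le0; apply/ler_addgt0Pr => e e0; rewrite add0r lerNl.
  pose b := W r0 + 468 / n%:R + 1.
  have b0 : 0 < b by rewrite /b ltr_wpDl // addr_ge0.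
  have t0 : 0 < b / e by rewrite divr_gt0.
  apply: le_trans (ub_le_sup hub (Sel _ t0)).
  rewrite ler_pdivlMr // mulNr [e * _]mulrC divfK ?gt_eqF //.
  by apply: aux2; exact: (mean_ksup_ge0 P Z K0 (ltW t0)).
by rewrite ler_sqr ?nnegrE.
Qed.
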